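(* Consider a functional PTS specification $(\mathcal S,\mathcal A,\mathcal R)$ in which $\mathcal A$ and $\mathcal R$ are total functions, its EPTS, and the sort-internalized Dedukti theory $(\Sigma^S_{EPTS},\mathscr R^S_{EPTS})$ completed as described below, with typing $\vdash_2$. Let $\Gamma$ be an EPTS context and $M,A$ EPTS terms. (1) If $\Gamma$ is well-formed then $[\![\Gamma]\!]_S$ is well-formed in $(\Sigma^S_{EPTS},\mathscr R^S_{EPTS})$. (2) If $\Gamma\vdash M:A$, then: if $A=s$ is a top-sort, $[\![\Gamma]\!]_S\vdash_2[\![M]\!]_S:\mathbf U\,\dot s$; otherwise $[\![\Gamma]\!]_S\vdash_2[\![M]\!]_S:\mathbf{El}\,\dot s_A\,[\![A]\!]_S$, where $\Gamma\vdash A:s_A$.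
   Context: EPTS: terms $x\mid s\mid\Pi_{s_1,s_2}(A,x.B)\mid\lambda_{s_1,s_2}(A,x.B,x.M)\mid@_{s_1,s_2}(A,x.B,M,N)$; reduction: context closure of $@_{s_1,s_2}(A,x.B,\lambda_{s_1,s_2}(A',x.B',x.M),N)\hookrightarrow M\{N/x\}$; typing: Empty, Decl, Conv, Var, Sort ($\mathcal A(s_1)=s_2$ gives $s_1:s_2$), Prod ($A:s_1$, $x:A\vdash B:s_2$ give $\Pi_{s_1,s_2}(A,x.B):\mathcal R(s_1,s_2)$), Abs (plus $x:A\vdash M:B$ gives $\lambda_{s_1,s_2}(A,x.B,x.M):\Pi_{s_1,s_2}(A,x.B)$), App ($A:s_1$, $x:A\vdash B:s_2$, $N:A$, $M:\Pi_{s_1,s_2}(A,x.B)$ give $@_{s_1,s_2}(A,x.B,M,N):B\{N/x\}$). A top-sort is a sort not in the domain of $\mathcal A$ (with $\mathcal A$ total there are none, but the statement is as given). Dedukti ($\lambda\Pi$-calculus with constants of fixed arity, conversion modulo $\beta$ and rewrite rules). Theory $(\Sigma^S_{EPTS},\mathscr R^S_{EPTS})$: $\hat{\mathcal S}:\mathtt{TYPE}$; $\hat{\mathcal A}[s_1:\hat{\mathcal S}]:\hat{\mathcal S}$; $\hat{\mathcal R}[s_1:\hat{\mathcal S};s_2:\hat{\mathcal S}]:\hat{\mathcal S}$; $\mathbf U[s:\hat{\mathcal S}]:\mathtt{TYPE}$; $\mathbf{El}[s:\hat{\mathcal S};A:\mathbf U\,s]:\mathtt{TYPE}$; $\mathbf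 u[s:\hat{\mathcal S}]:\mathbf U(\hat{\mathcal A}\,s)$; rule $\mathbf{El}\,s'(\mathbf u\,s)\hookrightarrow\mathbf U\,s$; $\mathbf{Prod}[s_1,s_2:\hat{\mathcal S};A:\mathbf U\,s_1;B:\mathbf{El}\,s_1A\to\mathbf U\,s_2]:\mathbf U(\hat{\mathcal R}s_1s_2)$; $\mathbf{abs}[s_1,s_2;A;B;N:\Pi x:\mathbf{El}\,s_1A.\mathbf{El}\,s_2(Bx)]:\mathbf{El}(\hat{\mathcal R}s_1s_2)(\mathbf{Prod}\,s_1s_2AB)$; $\mathbf{app}[s_1,s_2;A;B;M:\mathbf{El}(\hat{\mathcal R}s_1s_2)(\mathbf{Prod}\,s_1s_2AB);N:\mathbf{El}\,s_1A]:\mathbf{El}\,s_2(BN)$ (with $A:\mathbf U\,s_1$, $B:\mathbf{El}\,s_1A\to\mathbf U\,s_2$); rule $\mathbf{app}\,s_1s_2AB(\mathbf{abs}\,s_1's_2'A'B'M)N\hookrightarrow MN$. It is completed by constants and rules such that each $s\in\mathcal S$ has a representation $\dot s:\hat{\mathcal S}$ (restricting to a bijection with closed normal forms of type $\hat{\mathcal S}$), with $\mathcal A(s_1)=s_2$ iff $\hat{\mathcal A}\,\dot s_1\equiv\dot s_2$ and $\mathcal R(s_1,s_2)=s_3$ iff $\hat{\mathcal R}\,\dot s_1\,\dot s_2\equiv\dot s_3$. Translation: $[\![x]\!]_S=x$, $[\![s]\!]_S=\mathbf u\,\dot s$, $[\![\Pi_{s_1,s_2}(A,x.B)]\!]_S=\mathbf{Prod}\,\dot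 s_1\dot s_2[\![A]\!]_S(\lambda x:\mathbf{El}\,\dot s_1[\![A]\!]_S.[\![B]\!]_S)$, $[\![\lambda_{s_1,s_2}(A,x.B,x.M)]\!]_S=\mathbf{abs}\,\dot s_1\dot s_2[\![A]\!]_S(\lambda x:\mathbf{El}\,\dot s_1[\![A]\!]_S.[\![B]\!]_S)(\lambda x:\mathbf{El}\,\dot s_1[\![A]\!]_S.[\![M]\!]_S)$, $[\![@_{s_1,s_2}(A,x.B,M,N)]\!]_S=\mathbf{app}\,\dot s_1\dot s_2[\![A]\!]_S(\lambda x:\mathbf{El}\,\dot s_1[\![A]\!]_S.[\![B]\!]_S)[\![M]\!]_S[\![N]\!]_S$; $[\![-]\!]_S=-$, $[\![\Gamma,x:A]\!]_S=[\![\Gamma]\!]_S,x:\mathbf{El}\,\dot s_A[\![A]\!]_S$ where $\Gamma\vdash A:s_A$. *)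

(* Defs.v *)
From Stdlib Require Vector.
From Stdlib Require Import List Relations.

(** Binders are represented by de Bruijn indices, so terms are taken up to
    alpha-equivalence.  Contexts are lists with the most recent variable first;
    the type at position [n] lives in the context formed by the positions
    [> n]. *)

Definition up_ren (xi : nat -> nat) (n : nat) : nat :=
  match n with 0 => 0 | S m => S (xi m) end.

(** ** Pure type systems and their explicitly typed version *)

Record pts_spec : Type := {
  sort : Type;
  ax : sort -> sort -> Prop;
  rl : sort -> sort -> sort -> Prop }.

Definition pts_functional (P : pts_spec) : Prop :=
  (forall s s1 s2, ax P s s1 -> ax P s s2 -> s1 = s2) /\
  (forall s t u1 u2, rl P s t u1 -> rl P s t u2 -> u1 = u2).

Definition pts_total (P : pts_spec) : Prop :=
  (forall s, exists s', ax P s s') /\ (forall s t, exists u, rl P s t u).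

Definition top_sort (P : pts_spec) (s : sort P) : Prop :=
  ~ exists s', ax P s s'.

(** In [EProd s1 s2 A B], [ELam s1 s2 A B M] and [EApp s1 s2 A B M N], the
    subterm [B] is under one binder, and so is the [M] of [ELam]. *)
Inductive eterm (P : pts_spec) : Type :=
| EVar (n : nat)
| ESort (s : sort P)
| EProd (s1 s2 : sort P) (A B : eterm P)
| ELam (s1 s2 : sort P) (A B M : eterm P)
| EApp (s1 s2 : sort P) (A B M N : eterm P).
Arguments EVar {P} n.
Arguments ESort {P} s.
Arguments EProd {P} s1 s2 A B.
Arguments ELam {P} s1 s2 A B M.
Arguments EApp {P} s1 s2 A B M N.

Fixpoint eren {P} (xi : nat -> nat) (t : eterm P) : eterm P :=
  match t with
  | EVar n => EVar (xi n)
  | ESort s => ESort s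
  | EProd s1 s2 A B => EProd s1 s2 (eren xi A) (eren (up_ren xi) B)
  | ELam s1 s2 A B M =>
      ELam s1 s2 (eren xi A) (eren (up_ren xi) B) (eren (up_ren xi) M)
  | EApp s1 s2 A B M N =>
      EApp s1 s2 (eren xi A) (eren (up_ren xi) B) (eren xi M) (eren xi N)
  end.

Definition eup {P} (sigma : nat -> eterm P) (n : nat) : eterm P :=
  match n with 0 => EVar 0 | S m => eren S (sigma m) end.

Fixpoint esubst {P} (sigma : nat -> eterm P) (t : eterm P) : eterm P :=
  match t with
  | EVar n => sigma n
  | ESort s => ESort s
  | EProd s1 s2 A B => EProd s1 s2 (esubst sigma A) (esubst (eup sigma) B)
  | ELam s1 s2 A B M =>
      ELam s1 s2 (esubst sigma A) (esubst (eup sigma) B) (esubst (eup sigma) M)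
  | EApp s1 s2 A B M N =>
      EApp s1 s2 (esubst sigma A) (esubst (eup sigma) B)
        (esubst sigma M) (esubst sigma N)
  end.

(** [M{N/x}], where [x] is the variable of index 0 in [M]. *)
Definition esubst1 {P} (M N : eterm P) : eterm P :=
  esubst (fun n => match n with 0 => N | S m => EVar m end) M.

Inductive estep {P} : eterm P -> eterm P -> Prop :=
| estep_beta s1 s2 A B A' B' M N :
    estep (EApp s1 s2 A B (ELam s1 s2 A' B' M) N) (esubst1 M N)
| estep_prod1 s1 s2 A A' B :
    estep A A' -> estep (EProd s1 s2 A B) (EProd s1 s2 A' B)
| estep_prod2 s1 s2 A B B' :
    estep B B' -> estep (EProd s1 s2 A B) (EProd s1 s2 A B')
| estep_lam1 s1 s2 A A' B M :
    estep A A' -> estep (ELam s1 s2 A B M) (ELam s1 s2 A' B M)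
| estep_lam2 s1 s2 A B B' M :
    estep B B' -> estep (ELam s1 s2 A B M) (ELam s1 s2 A B' M)
| estep_lam3 s1 s2 A B M M' :
    estep M M' -> estep (ELam s1 s2 A B M) (ELam s1 s2 A B M')
| estep_app1 s1 s2 A A' B M N :
    estep A A' -> estep (EApp s1 s2 A B M N) (EApp s1 s2 A' B M N)
| estep_app2 s1 s2 A B B' M N :
    estep B B' -> estep (EApp s1 s2 A B M N) (EApp s1 s2 A B' M N)
| estep_app3 s1 s2 A B M M' N :
    estep M M' -> estep (EApp s1 s2 A B M N) (EApp s1 s2 A B M' N)
| estep_app4 s1 s2 A B M N N' :
    estep N N' -> estep (EApp s1 s2 A B M N) (EApp s1 s2 A B M N').

Definition econv {P} : eterm P -> eterm P -> Prop :=
  clos_refl_sym_trans (eterm P) estep.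

Definition ectx (P : pts_spec) : Type := list (eterm P).

Inductive ewf {P} : ectx P -> Prop :=
| ewf_empty : ewf nil
| ewf_decl G A s : ety G A (ESort s) -> ewf (A :: G)
with ety {P} : ectx P -> eterm P -> eterm P -> Prop :=
| ety_var G n A :
    ewf G -> nth_error G n = Some A ->
    ety G (EVar n) (eren (fun m => S n + m) A)
| ety_sort G s1 s2 :
    ewf G -> ax P s1 s2 -> ety G (ESort s1) (ESort s2)
| ety_prod G s1 s2 s3 A B :
    ety G A (ESort s1) -> ety (A :: G) B (ESort s2) -> rl P s1 s2 s3 ->
    ety G (EProd s1 s2 A B) (ESort s3)
| ety_abs G s1 s2 A B M :
    ety G A (ESort s1) -> ety (A :: G) B (ESort s2) ->
    ety (A :: G) M B ->
    ety G (ELam s1 s2 A B M) (EProd s1 s2 A B)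
| ety_app G s1 s2 A B M N :
    ety G A (ESort s1) -> ety (A :: G) B (ESort s2) ->
    ety G N A -> ety G M (EProd s1 s2 A B) ->
    ety G (EApp s1 s2 A B M N) (esubst1 B N)
| ety_conv G M A B s :
    ety G M A -> ety G B (ESort s) -> econv A B -> ety G M B.

(** ** Dedukti: the lambda-Pi-calculus with constants of fixed arity, modulo
    beta and rewrite rules *)

Record lang : Type := { cst : Type; ar : cst -> nat }.

Inductive dterm (L : lang) : Type :=
| DVar (n : nat)
| DCst (c : cst L) (args : Vector.t (dterm L) (ar L c))
| DType
| DKind
| DPi (A B : dterm L)
| DLam (A M : dterm L)
| DApp (M N : dterm L).
Arguments DVar {L} n.
Arguments DCst {L} c args.
Arguments DType {L}.
Arguments DKind {L}.
Arguments DPi {L} A B.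
Arguments DLam {L} A M.
Arguments DApp {L} M N.

Fixpoint dren {L} (xi : nat -> nat) (t : dterm L) : dterm L :=
  match t with
  | DVar n => DVar (xi n)
  | DCst c args => DCst c (Vector.map (dren xi) args)
  | DType => DType
  | DKind => DKind
  | DPi A B => DPi (dren xi A) (dren (up_ren xi) B)
  | DLam A M => DLam (dren xi A) (dren (up_ren xi) M)
  | DApp M N => DApp (dren xi M) (dren xi N)
  end.

Definition dup {L} (sigma : nat -> dterm L) (n : nat) : dterm L :=
  match n with 0 => DVar 0 | S m => dren S (sigma m) end.

Fixpoint dsubst {L} (sigma : nat -> dterm L) (t : dterm L) : dterm L :=
  match t with
  | DVar n => sigma n
  | DCst c args => DCst c (Vector.map (dsubst sigma) args)
  | DType => DType
  | DKind => DKind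
  | DPi A B => DPi (dsubst sigma A) (dsubst (dup sigma) B)
  | DLam A M => DLam (dsubst sigma A) (dsubst (dup sigma) M)
  | DApp M N => DApp (dsubst sigma M) (dsubst sigma N)
  end.

Definition dsubst1 {L} (M N : dterm L) : dterm L :=
  dsubst (fun n => match n with 0 => N | S m => DVar m end) M.

(** Substitution of the list [M_1, ..., M_k] for the variables
    [x_1, ..., x_k] of a context [x_1 : A_1, ..., x_k : A_k]; the variable
    [x_k] is the one of index 0. *)
Definition dinst {L} (Ms : list (dterm L)) (n : nat) : dterm L :=
  nth n (List.rev Ms) (DVar (n - length Ms)).

(** The rewrite rule [c[l_1, ..., l_k] --> r]; its variables are the free
    indices of its two sides. *)
Record rule (L : lang) : Type := {
  rule_cst : cst L;
  rule_args : Vector.t (dterm L) (ar L rule_cst);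
  rule_rhs : dterm L }.
Arguments rule_cst {L} _.
Arguments rule_args {L} _.
Arguments rule_rhs {L} _.

(** [c] is declared as [c[x_1 : A_1; ...; x_k : A_k] : A], where
    [decl_ctx c] is [A_1; ...; A_k] in this order, the term [A_i] being over
    [x_1, ..., x_(i-1)], and [decl_ty c] is [A], over [x_1, ..., x_k]. *)
Record theory (L : lang) : Type := {
  decl_ctx : forall c : cst L, Vector.t (dterm L) (ar L c);
  decl_ty : cst L -> dterm L;
  rules : rule L -> Prop }.
Arguments decl_ctx {L} _ c.
Arguments decl_ty {L} _ c.
Arguments rules {L} _ _.

Inductive dstep {L} (T : theory L) : dterm L -> dterm L -> Prop :=
| dstep_beta A M N : dstep T (DApp (DLam A M) N) (dsubst1 M N)
| dstep_rule (r : rule L) (sigma : nat -> dterm L) :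
    rules T r ->
    dstep T (dsubst sigma (DCst (rule_cst r) (rule_args r)))
            (dsubst sigma (rule_rhs r))
| dstep_cst c args i M :
    dstep T (Vector.nth args i) M ->
    dstep T (DCst c args) (DCst c (Vector.replace args i M))
| dstep_pi1 A A' B : dstep T A A' -> dstep T (DPi A B) (DPi A' B)
| dstep_pi2 A B B' : dstep T B B' -> dstep T (DPi A B) (DPi A B')
| dstep_lam1 A A' M : dstep T A A' -> dstep T (DLam A M) (DLam A' M)
| dstep_lam2 A M M' : dstep T M M' -> dstep T (DLam A M) (DLam A M')
| dstep_app1 M M' N : dstep T M M' -> dstep T (DApp M N) (DApp M' N)
| dstep_app2 M N N' : dstep T N N' -> dstep T (DApp M N) (DApp M N').

Definition dconv {L} (T : theory L) : dterm L -> dterm L -> Prop :=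
  clos_refl_sym_trans (dterm L) (dstep T).

Definition dnormal {L} (T : theory L) (t : dterm L) : Prop :=
  forall t', ~ dstep T t t'.

Definition dsort {L} (t : dterm L) : Prop := t = DType \/ t = DKind.

Definition dctx (L : lang) : Type := list (dterm L).

Inductive dwf {L} (T : theory L) : dctx L -> Prop :=
| dwf_empty : dwf T nil
| dwf_decl G A : dty T G A DType -> dwf T (A :: G)
with dty {L} (T : theory L) : dctx L -> dterm L -> dterm L -> Prop :=
| dty_var G n A :
    dwf T G -> nth_error G n = Some A ->
    dty T G (DVar n) (dren (fun m => S n + m) A)
| dty_sort G : dwf T G -> dty T G DType DKind
| dty_cst G c args s :
    dwf T G ->
    dty T (List.rev (Vector.to_list (decl_ctx T c))) (decl_ty T c) s ->
    dsort s ->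
    (forall i M A,
        nth_error (Vector.to_list args) i = Some M ->
        nth_error (Vector.to_list (decl_ctx T c)) i = Some A ->
        dty T G M (dsubst (dinst (firstn i (Vector.to_list args))) A)) ->
    dty T G (DCst c args)
      (dsubst (dinst (Vector.to_list args)) (decl_ty T c))
| dty_prod G A B s :
    dty T G A DType -> dty T (A :: G) B s -> dsort s ->
    dty T G (DPi A B) s
| dty_abs G A B M s :
    dty T G A DType -> dty T (A :: G) B s -> dsort s ->
    dty T (A :: G) M B ->
    dty T G (DLam A M) (DPi A B)
| dty_app G A B M N :
    dty T G M (DPi A B) -> dty T G N A ->
    dty T G (DApp M N) (dsubst1 B N)
| dty_conv G M A B s :
    dty T G M A -> dty T G B s -> dsort s -> dconv T A B -> dty T G M B.

(** ** The Dedukti theory with internalized sorts *)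

Inductive scst (X : Type) : Type :=
| KS | KA | KR | KU | KEl | Ku | KProd | Kabs | Kapp
| Kext (x : X).
Arguments KS {X}.
Arguments KA {X}.
Arguments KR {X}.
Arguments KU {X}.
Arguments KEl {X}.
Arguments Ku {X}.
Arguments KProd {X}.
Arguments Kabs {X}.
Arguments Kapp {X}.
Arguments Kext {X} x.

(** The constants of the encoding, together with those, taken from [E], by
    which it is completed. *)
Definition slang (E : lang) : lang := {|
  cst := scst (cst E);
  ar := fun c =>
    match c with
    | KS => 0 | KA => 1 | KR => 2 | KU => 1 | KEl => 2 | Ku => 1
    | KProd => 4 | Kabs => 5 | Kapp => 6
    | Kext x => ar E x
    end |}.

Section Constants.
Context {E : lang}.
Import Vector.VectorNotations.
Local Notation tm := (dterm (slang E)).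

Definition hatS : tm := @DCst (slang E) KS [].
Definition hatA (s : tm) : tm := @DCst (slang E) KA [s].
Definition hatR (s1 s2 : tm) : tm := @DCst (slang E) KR [s1; s2].
Definition dU (s : tm) : tm := @DCst (slang E) KU [s].
Definition dEl (s A : tm) : tm := @DCst (slang E) KEl [s; A].
Definition du (s : tm) : tm := @DCst (slang E) Ku [s].
Definition dProd (s1 s2 A B : tm) : tm :=
  @DCst (slang E) KProd [s1; s2; A; B].
Definition dabs (s1 s2 A B N : tm) : tm :=
  @DCst (slang E) Kabs [s1; s2; A; B; N].
Definition dapp (s1 s2 A B M N : tm) : tm :=
  @DCst (slang E) Kapp [s1; s2; A; B; M; N].

Local Notation "# n" := (DVar n) (at level 0, n at level 0).

Definition sdecl_ctx (ext : forall x : cst E, Vector.t tm (ar E x))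
    (c : scst (cst E)) : Vector.t tm (ar (slang E) c) :=
  match c return Vector.t tm (ar (slang E) c) with
  | KS => []
  | KA => [hatS]
  | KR => [hatS; hatS]
  | KU => [hatS]
  | KEl => [hatS; dU #0]
  | Ku => [hatS]
  | KProd => [hatS; hatS; dU #1; DPi (dEl #2 #0) (dU #2)]
  | Kabs => [hatS; hatS; dU #1; DPi (dEl #2 #0) (dU #2);
             DPi (dEl #3 #1) (dEl #3 (DApp #1 #0))]
  | Kapp => [hatS; hatS; dU #1; DPi (dEl #2 #0) (dU #2);
             dEl (hatR #3 #2) (dProd #3 #2 #1 #0);
             dEl #4 #2]
  | Kext x => ext x
  end.

Definition sdecl_ty (ext : cst E -> tm) (c : scst (cst E)) : tm :=
  match c with
  | KS => DType
  | KA => hatS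
  | KR => hatS
  | KU => DType
  | KEl => DType
  | Ku => dU (hatA #0)
  | KProd => dU (hatR #3 #2)
  | Kabs => dEl (hatR #4 #3) (dProd #4 #3 #2 #1)
  | Kapp => dEl #4 (DApp #2 #0)
  | Kext x => ext x
  end.

(** [El s' (u s) --> U s], with [s'] and [s] of indices 1 and 0. *)
Definition rule_El : rule (slang E) := {|
  rule_cst := KEl : cst (slang E);
  rule_args := [#1; du #0];
  rule_rhs := dU #0 |}.

(** [app s1 s2 A B (abs s1' s2' A' B' M) N --> M N], where the variables
    [s1, s2, A, B, s1', s2', A', B', M, N] have indices 9 down to 0. *)
Definition rule_app : rule (slang E) := {|
  rule_cst := Kapp : cst (slang E);
  rule_args := [#9; #8; #7; #6; dabs #5 #4 #3 #2 #1; #0];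
  rule_rhs := DApp #1 #0 |}.

End Constants.

(** The constants, declarations and rules by which the encoding is completed,
    and the representation of sorts. *)
Record completion (P : pts_spec) : Type := {
  ext_lang : lang;
  ext_decl_ctx :
    forall x : cst ext_lang,
      Vector.t (dterm (slang ext_lang)) (ar ext_lang x);
  ext_decl_ty : cst ext_lang -> dterm (slang ext_lang);
  ext_rules : rule (slang ext_lang) -> Prop;
  dot : sort P -> dterm (slang ext_lang) }.
Arguments ext_lang {P} _.
Arguments ext_decl_ctx {P} _ x.
Arguments ext_decl_ty {P} _ x.
Arguments ext_rules {P} _ _.
Arguments dot {P} _ s.

Definition stheory {P} (K : completion P) : theory (slang (ext_lang K)) :=
  Build_theory (slang (ext_lang K))
    (sdecl_ctx (ext_decl_ctx K))
    (sdecl_ty (ext_decl_ty K))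
    (fun r => r = rule_El \/ r = rule_app \/ ext_rules K r).

(** The first two clauses say that [dot] is a bijection between the sorts and
    the closed normal forms of type [hatS]. *)
Definition represents_sorts {P} (K : completion P) : Prop :=
  (forall t, (exists s, t = dot K s) <->
             (dty (stheory K) nil t hatS /\ dnormal (stheory K) t)) /\
  (forall s1 s2, dot K s1 = dot K s2 -> s1 = s2) /\
  (forall s1 s2, ax P s1 s2 <->
     dconv (stheory K) (hatA (dot K s1)) (dot K s2)) /\
  (forall s1 s2 s3, rl P s1 s2 s3 <->
     dconv (stheory K) (hatR (dot K s1) (dot K s2)) (dot K s3)).

(** No lifting of [dot K s] is needed under binders: it is closed. *)
Fixpoint tr {P} (K : completion P) (t : eterm P)
    : dterm (slang (ext_lang K)) :=
  match t with
  | EVar n => DVar n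
  | ESort s => du (dot K s)
  | EProd s1 s2 A B =>
      dProd (dot K s1) (dot K s2) (tr K A)
        (DLam (dEl (dot K s1) (tr K A)) (tr K B))
  | ELam s1 s2 A B M =>
      dabs (dot K s1) (dot K s2) (tr K A)
        (DLam (dEl (dot K s1) (tr K A)) (tr K B))
        (DLam (dEl (dot K s1) (tr K A)) (tr K M))
  | EApp s1 s2 A B M N =>
      dapp (dot K s1) (dot K s2) (tr K A)
        (DLam (dEl (dot K s1) (tr K A)) (tr K B))
        (tr K M) (tr K N)
  end.

(** [tr_ctx K G D]: [D] is the translation of [G].  It is a relation because
    the translation refers to the sort [s] such that [G |- A : s]. *)
Inductive tr_ctx {P} (K : completion P)
    : ectx P -> dctx (slang (ext_lang K)) -> Prop :=
| tr_ctx_empty : tr_ctx K nil nil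
| tr_ctx_decl G D A s :
    tr_ctx K G D -> ety G A (ESort s) ->
    tr_ctx K (A :: G) (dEl (dot K s) (tr K A) :: D).

(* Main.v *)
Require Import Defs.
From Stdlib Require Vector.
From Stdlib Require Import List Relations Lia.

(** Weakening, substitution, confluence, subject reduction and uniqueness of
    types for the EPTS give every EPTS type [A] a unique sort, and convertible
    types the same sort.  This makes the annotation of [El] well defined and
    compatible with the conversion rule.  The translation commutes with
    substitution, because the representations of sorts are closed, and sends a
    beta step to an instance of the [app]-[abs] rule followed by a Dedukti beta
    step, so it preserves conversion.  Typing is then preserved by induction on
    derivations; subject reduction and confluence of the Dedukti theory, which
    may fail for its arbitrary completion, are not needed: its substitution
    lemma suffices to type the contracta of the redexes that the translation
    creates. *)

(** * Substitution in EPTS terms *)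

Lemma esubst_ext {P} (t : eterm P) : forall sigma tau,
  (forall n, sigma n = tau n) -> esubst sigma t = esubst tau t.
Proof.
  induction t; intros sigma tau eq; simpl; f_equal; auto;
    match goal with H : context [esubst _ ?t = _] |- esubst _ ?t = _ => apply H end;
    intros [|n]; simpl; congruence.
Qed.

Lemma eren_esubst {P} (t : eterm P) :
  forall xi, eren xi t = esubst (fun n => EVar (xi n)) t.
Proof.
  induction t; intros xi; simpl; f_equal; auto;
    match goal with H : context [eren _ ?t = _] |- eren _ ?t = _ => rewrite H end;
    apply esubst_ext; intros [|n]; reflexivity.
Qed.

Lemma esubst_eren {P} (t : eterm P) : forall xi sigma,
  esubst sigma (eren xi t) = esubst (fun n => sigma (xi n)) t.
Proof.
  induction t; intros xi sigma; simpl; f_equal; auto;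
    match goal with H : context [eren _ ?t] |- context [eren _ ?t] => rewrite H end;
    apply esubst_ext; intros [|n]; reflexivity.
Qed.

Lemma eren_eren {P} (t : eterm P) xi zeta :
  eren zeta (eren xi t) = eren (fun n => zeta (xi n)) t.
Proof. rewrite (eren_esubst (eren xi t)), esubst_eren, eren_esubst; reflexivity. Qed.

Lemma eren_after_esubst {P} (t : eterm P) : forall sigma xi,
  eren xi (esubst sigma t) = esubst (fun n => eren xi (sigma n)) t.
Proof.
  induction t; intros sigma xi; simpl; f_equal; auto;
    match goal with H : context [esubst _ ?t] |- context [eren _ (esubst _ ?t)] => rewrite H end;
    apply esubst_ext; intros [|n]; simpl; rewrite ?eren_eren; reflexivity.
Qed.

Lemma esubst_esubst {P} (t : eterm P) : forall sigma tau,
  esubst tau (esubst sigma t) = esubst (fun n => esubst tau (sigma n)) t.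
Proof.
  induction t; intros sigma tau; simpl; f_equal; auto;
    match goal with H : context [esubst _ ?t] |- context [esubst _ (esubst _ ?t)] => rewrite H end;
    apply esubst_ext; intros [|n]; simpl;
    rewrite ?esubst_eren, ?eren_after_esubst; reflexivity.
Qed.

Lemma esubst_id {P} (t : eterm P) : forall sigma,
  (forall n, sigma n = EVar n) -> esubst sigma t = t.
Proof.
  induction t; intros sigma eq; simpl; f_equal; auto;
    match goal with H : context [esubst _ ?t = _] |- esubst _ ?t = _ => apply H end;
    intros [|n]; simpl; rewrite ?eq; reflexivity.
Qed.

Lemma esubst_esubst1 {P} (B N : eterm P) sigma :
  esubst sigma (esubst1 B N) = esubst1 (esubst (eup sigma) B) (esubst sigma N).
Proof.
  unfold esubst1; rewrite !esubst_esubst; apply esubst_ext; intros [|n]; simpl;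
    rewrite ?esubst_eren; [|rewrite esubst_id]; reflexivity.
Qed.

(** * Confluence of EPTS reduction *)

(** Tait and Martin-Löf's parallel reduction. The beta clause drops the four type annotations of a
    redex without comparing or reducing them, so redexes stay left-linear; the labels [s1] and [s2],
    which must agree, never change under reduction. *)
Inductive epar {P} : eterm P -> eterm P -> Prop :=
| epar_beta s1 s2 A B A' B' M M' N N' :
    epar M M' -> epar N N' ->
    epar (EApp s1 s2 A B (ELam s1 s2 A' B' M) N) (esubst1 M' N')
| epar_var n : epar (EVar n) (EVar n)
| epar_sort s : epar (ESort s) (ESort s)
| epar_prod s1 s2 A A' B B' :
    epar A A' -> epar B B' -> epar (EProd s1 s2 A B) (EProd s1 s2 A' B')
| epar_lam s1 s2 A A' B B' M M' :
    epar A A' -> epar B B' -> epar M M' ->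
    epar (ELam s1 s2 A B M) (ELam s1 s2 A' B' M')
| epar_app s1 s2 A A' B B' M M' N N' :
    epar A A' -> epar B B' -> epar M M' -> epar N N' ->
    epar (EApp s1 s2 A B M N) (EApp s1 s2 A' B' M' N').

Lemma epar_refl {P} (t : eterm P) : epar t t.
Proof. induction t; constructor; assumption. Qed.

Lemma epar_esubst {P} (M M' : eterm P) : epar M M' ->
  forall sigma tau, (forall n, epar (sigma n) (tau n)) ->
  epar (esubst sigma M) (esubst tau M').
Proof.
  (* Renamings come first, since pushing a substitution under a binder renames its values. *)
  assert (ren : forall M M' : eterm P, epar M M' -> forall xi, epar (eren xi M) (eren xi M')).
  { clear M M'; induction 1; intros xi; simpl; try (constructor; auto).
    replace (eren xi (esubst1 M' N')) with (esubst1 (eren (up_ren xi) M') (eren xi N')).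
    - constructor; auto.
    - rewrite !(eren_esubst _ xi), esubst_esubst1; f_equal.
      rewrite eren_esubst; apply esubst_ext; intros [|n]; reflexivity. }
  assert (up : forall sigma tau : nat -> eterm P, (forall n, epar (sigma n) (tau n)) ->
             forall n, epar (eup sigma n) (eup tau n)).
  { intros sigma tau H [|n]; simpl; [constructor | auto]. }
  induction 1; intros sigma tau Hst; simpl; auto; try (constructor; auto).
  rewrite esubst_esubst1; constructor; auto.
Qed.

Lemma epar_esubst1 {P} (M M' N N' : eterm P) :
  epar M M' -> epar N N' -> epar (esubst1 M N) (esubst1 M' N').
Proof.
  intros HM HN; apply epar_esubst; auto; intros [|n]; auto; constructor.
Qed.

(** The one overlap is between contracting a redex and reducing its parts. A reduct of an
    abstraction is again an abstraction with the same labels, so the contraction can still be made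
    afterwards. *)
Lemma epar_diamond {P} (M N1 : eterm P) : epar M N1 ->
  forall N2, epar M N2 -> exists Q, epar N1 Q /\ epar N2 Q.
Proof.
  induction 1 as [s1 s2 A B A' B' M M' N N' HM IHM HN IHN | | | | |
                  s1 s2 A A' B B' M M' N N' HA IHA HB IHB HM IHM HN IHN];
    intros N2 H2.
  - inversion H2; subst.
    + destruct (IHM _ ltac:(eassumption)) as (Q1 & ? & ?).
      destruct (IHN _ ltac:(eassumption)) as (Q2 & ? & ?).
      exists (esubst1 Q1 Q2); split; apply epar_esubst1; assumption.
    + match goal with H : epar (ELam _ _ _ _ _) _ |- _ => inversion H; subst end.
      destruct (IHM _ ltac:(eassumption)) as (Q1 & ? & ?).
      destruct (IHN _ ltac:(eassumption)) as (Q2 & ? & ?).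
      exists (esubst1 Q1 Q2); split; [apply epar_esubst1 | constructor]; assumption.
  - exists N2; split; [assumption | apply epar_refl].
  - exists N2; split; [assumption | apply epar_refl].
  - inversion H2; subst.
    destruct (IHepar1 _ ltac:(eassumption)) as (Q1 & ? & ?).
    destruct (IHepar2 _ ltac:(eassumption)) as (Q2 & ? & ?).
    eexists; split; constructor; eassumption.
  - inversion H2; subst.
    destruct (IHepar1 _ ltac:(eassumption)) as (Q1 & ? & ?).
    destruct (IHepar2 _ ltac:(eassumption)) as (Q2 & ? & ?).
    destruct (IHepar3 _ ltac:(eassumption)) as (Q3 & ? & ?).
    eexists; split; constructor; eassumption.
  - inversion H2; subst.
    (* The contraction only reduced the body of the abstraction; rewrapping that reduct in the
       untouched annotations gives a reduct of the whole function, to which the induction hypothesis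
       applies. *)
    + destruct (IHM (ELam s1 s2 A'0 B'0 M'0)) as (Q1 & HQ1 & HQ2).
      { constructor; auto using epar_refl. }
      destruct (IHN _ ltac:(eassumption)) as (Q2 & ? & ?).
      inversion HM; subst; inversion HQ1; subst; inversion HQ2; subst.
      eexists; split; [apply epar_beta | apply epar_esubst1]; eassumption.
    + destruct (IHA _ ltac:(eassumption)) as (Q1 & ? & ?).
      destruct (IHB _ ltac:(eassumption)) as (Q2 & ? & ?).
      destruct (IHM _ ltac:(eassumption)) as (Q3 & ? & ?).
      destruct (IHN _ ltac:(eassumption)) as (Q4 & ? & ?).
      eexists; split; constructor; eassumption.
Qed.

Definition epars {P} : eterm P -> eterm P -> Prop := clos_refl_trans_1n (eterm P) epar.

Lemma epars_trans {P} (M N Q : eterm P) : epars M N -> epars N Q -> epars M Q.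
Proof.
  intros H HQ; induction H as [|M M1 N H1 _ IH]; [assumption |].
  econstructor 2; [exact H1 | exact (IH HQ)].
Qed.

Lemma epars_strip {P} (M N : eterm P) : epars M N ->
  forall M', epar M M' -> exists N', epar N N' /\ epars M' N'.
Proof.
  induction 1 as [M | M M1 N H1 _ IH]; intros M' H'.
  - exists M'; split; [assumption | constructor].
  - destruct (epar_diamond _ _ H1 _ H') as (Q & HQ1 & HQ2).
    destruct (IH _ HQ1) as (N' & ? & ?).
    exists N'; split; [assumption | econstructor; eassumption].
Qed.

Lemma epars_confluent {P} (M N1 : eterm P) : epars M N1 ->
  forall N2, epars M N2 -> exists Q, epars N1 Q /\ epars N2 Q.
Proof.
  induction 1 as [M | M M1 N H1 _ IH]; intros N2 H2.
  - exists N2; split; [assumption | constructor].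
  - destruct (epars_strip _ _ H2 _ H1) as (Q & HQ1 & HQ2).
    destruct (IH _ HQ2) as (Q' & ? & ?).
    exists Q'; split; [assumption | econstructor; eassumption].
Qed.

(** * Church-Rosser property and conversion of sorts and products *)

Lemma estep_epar {P} (M N : eterm P) : estep M N -> epar M N.
Proof. induction 1; constructor; auto using epar_refl. Qed.

Lemma church_rosser {P} (M N : eterm P) :
  econv M N -> exists Q, epars M Q /\ epars N Q.
Proof.
  induction 1 as [M N H | M | M N _ (Q & ? & ?) | M N N' _ (Q & HQ1 & HQ2) _ (Q' & HQ3 & HQ4)].
  - exists N; split; [econstructor; [apply estep_epar; eassumption|] |]; constructor.
  - exists M; split; constructor.
  - exists Q; auto.
  - destruct (epars_confluent _ _ HQ2 _ HQ3) as (R & ? & ?).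
    exists R; eauto using epars_trans.
Qed.

Definition esteps {P} : eterm P -> eterm P -> Prop := clos_refl_trans (eterm P) estep.

Lemma esteps_map {P} (C : eterm P -> eterm P) :
  (forall M N, estep M N -> estep (C M) (C N)) ->
  forall M N, esteps M N -> esteps (C M) (C N).
Proof.
  intros HC; induction 1; [apply rt_step; auto | apply rt_refl | eapply rt_trans; eauto].
Qed.

(** The way back to single steps: it turns the common reducts of Church-Rosser into conversions and
    lets subject reduction, proved for [estep], act along [epars]. *)
Lemma epar_esteps {P} (M N : eterm P) : epar M N -> esteps M N.
Proof.
  induction 1.
  (* Body and argument are reduced inside the redex, which is contracted last. *)
  - apply rt_trans with (EApp s1 s2 A B (ELam s1 s2 A' B' M') N').
    + apply rt_trans with (EApp s1 s2 A B (ELam s1 s2 A' B' M') N).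
      * apply (esteps_map (fun M => EApp s1 s2 A B (ELam s1 s2 A' B' M) N)); auto.
        intros; apply estep_app3, estep_lam3; assumption.
      * apply (esteps_map (EApp s1 s2 A B (ELam s1 s2 A' B' M'))); auto; constructor; auto.
    + apply rt_step; constructor.
  - apply rt_refl.
  - apply rt_refl.
  - apply rt_trans with (EProd s1 s2 A' B).
    + apply (esteps_map (fun A => EProd s1 s2 A B)); auto; constructor; auto.
    + apply (esteps_map (EProd s1 s2 A')); auto; constructor; auto.
  - apply rt_trans with (ELam s1 s2 A' B M); [|apply rt_trans with (ELam s1 s2 A' B' M)].
    + apply (esteps_map (fun A => ELam s1 s2 A B M)); auto; constructor; auto.
    + apply (esteps_map (fun B => ELam s1 s2 A' B M)); auto; constructor; auto.
    + apply (esteps_map (ELam s1 s2 A' B')); auto; constructor; auto.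
  - apply rt_trans with (EApp s1 s2 A' B M N); [|apply rt_trans with (EApp s1 s2 A' B' M N);
      [|apply rt_trans with (EApp s1 s2 A' B' M' N)]].
    + apply (esteps_map (fun A => EApp s1 s2 A B M N)); auto; constructor; auto.
    + apply (esteps_map (fun B => EApp s1 s2 A' B M N)); auto; constructor; auto.
    + apply (esteps_map (fun M => EApp s1 s2 A' B' M N)); auto; constructor; auto.
    + apply (esteps_map (EApp s1 s2 A' B' M')); auto; constructor; auto.
Qed.

Lemma esteps_econv {P} (M N : eterm P) : esteps M N -> econv M N.
Proof.
  induction 1; [apply rst_step; auto | apply rst_refl | eapply rst_trans; eauto].
Qed.

Lemma epars_econv {P} (M N : eterm P) : epars M N -> econv M N.
Proof.
  induction 1; [apply rst_refl |].
  eapply rst_trans; [apply esteps_econv, epar_esteps |]; eassumption.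
Qed.

Lemma epars_sort {P} (s : sort P) N : epars (ESort s) N -> N = ESort s.
Proof.
  intros H; remember (ESort s) as M eqn:E; induction H as [|M M1 N H1 _ IH]; [auto|].
  subst; inversion H1; subst; auto.
Qed.

Lemma epars_prod {P} (s1 s2 : sort P) M N : epars M N ->
  forall A B, M = EProd s1 s2 A B ->
  exists A' B', N = EProd s1 s2 A' B' /\ epars A A' /\ epars B B'.
Proof.
  induction 1 as [M | M M1 N H1 _ IH]; intros A B ->.
  - exists A, B; repeat split; constructor.
  - inversion H1; subst.
    destruct (IH _ _ eq_refl) as (A1 & B1 & -> & ? & ?).
    exists A1, B1; repeat split; econstructor; eassumption.
Qed.

Lemma econv_sort_inj {P} (s s' : sort P) : econv (ESort s) (ESort s') -> s = s'.
Proof.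
  intros (Q & H1 & H2)%church_rosser.
  apply epars_sort in H1; apply epars_sort in H2; congruence.
Qed.

(** The common reduct is a product whose components were reduced independently. In subject reduction
    this relates the annotations of an abstraction to those of the application around it. *)
Lemma econv_prod_inj {P} (s1 s2 : sort P) A B A' B' :
  econv (EProd s1 s2 A B) (EProd s1 s2 A' B') -> econv A A' /\ econv B B'.
Proof.
  intros (Q & H1 & H2)%church_rosser.
  destruct (epars_prod _ _ _ _ H1 _ _ eq_refl) as (A1 & B1 & -> & HA & HB).
  destruct (epars_prod _ _ _ _ H2 _ _ eq_refl) as (A2 & B2 & [= <- <-] & HA' & HB').
  split; (eapply rst_trans; [|apply rst_sym]; apply epars_econv; eassumption).
Qed.

Lemma econv_map {P} (C : eterm P -> eterm P) :
  (forall M N, estep M N -> econv (C M) (C N)) ->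
  forall M N, econv M N -> econv (C M) (C N).
Proof.
  intros HC; induction 1;
    [auto | apply rst_refl | apply rst_sym; auto | eapply rst_trans; eauto].
Qed.

Lemma econv_esubst {P} (M N : eterm P) sigma :
  econv M N -> econv (esubst sigma M) (esubst sigma N).
Proof.
  apply (econv_map (esubst sigma)); intros; apply esteps_econv, epar_esteps, epar_esubst.
  - apply estep_epar; assumption.
  - intros; apply epar_refl.
Qed.

(** * Metatheory of EPTS typing *)

Lemma ety_ewf {P} (G : ectx P) M A : ety G M A -> ewf G.
Proof. induction 1; auto. Qed.

(* Any class of typed substitutions that is closed under going below a binder
   acts on derivations; it is applied first to renamings and then, weakening
   being available, to arbitrary typed substitutions. *)
Lemma ety_esubst_class {P} (R : ectx P -> ectx P -> (nat -> eterm P) -> Prop)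
    (R_var : forall G D sigma n A, R G D sigma -> ewf D -> nth_error G n = Some A ->
       ety D (sigma n) (esubst (fun m => sigma (S n + m)) A))
    (R_up : forall G D sigma A s, R G D sigma -> ety D (esubst sigma A) (ESort s) ->
       R (A :: G) (esubst sigma A :: D) (eup sigma))
    (G : ectx P) M A : ety G M A ->
  forall D sigma, R G D sigma -> ewf D -> ety D (esubst sigma M) (esubst sigma A).
Proof.
  induction 1; intros D sigma HR HD; simpl.
  - rewrite esubst_eren; eauto.
  - constructor; assumption.
  - assert (HA := IHety1 _ _ HR HD); simpl in HA.
    econstructor; [assumption | | eassumption].
    apply (IHety2 (esubst sigma A :: D) (eup sigma)); eauto using ewf_decl.
  - assert (HA := IHety1 _ _ HR HD); simpl in HA.
    assert (HRA := R_up _ _ _ _ _ HR HA); assert (HDA := ewf_decl _ _ _ HA).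
    constructor; [assumption | apply (IHety2 _ _ HRA HDA) | apply (IHety3 _ _ HRA HDA)].
  - assert (HA := IHety1 _ _ HR HD); simpl in HA.
    assert (HRA := R_up _ _ _ _ _ HR HA); assert (HDA := ewf_decl _ _ _ HA).
    rewrite esubst_esubst1; constructor;
      [assumption | apply (IHety2 _ _ HRA HDA) | auto | apply (IHety4 _ _ HR HD)].
  - econstructor; [eauto | apply (IHety2 _ _ HR HD) | apply econv_esubst; assumption].
Qed.

(** Renamings are presented as substitutions whose values are variables, so that they fall under
    [ety_esubst_class]. The last equation compares the two declared types after each is moved into
    its full context. *)
Definition ectx_ren {P} (G D : ectx P) (sigma : nat -> eterm P) : Prop :=
  forall n A, nth_error G n = Some A -> exists m A',
    sigma n = EVar m /\ nth_error D m = Some A' /\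
    eren (fun k => S m + k) A' = esubst (fun k => sigma (S n + k)) A.

Lemma ety_ectx_ren {P} (G D : ectx P) sigma M A :
  ectx_ren G D sigma -> ewf D -> ety G M A -> ety D (esubst sigma M) (esubst sigma A).
Proof.
  intros HR HD HM; revert HM D sigma HR HD; apply ety_esubst_class.
  - intros G' D sigma n B HR HD Hn.
    destruct (HR _ _ Hn) as (m & B' & -> & Hm & <-); constructor; assumption.
  - intros G' D sigma B s HR _ [|n] C HC.
    + injection HC as <-.
      exists 0, (esubst sigma B); repeat split; apply eren_after_esubst.
    + destruct (HR _ _ HC) as (m & C' & Hs & Hm & HC').
      exists (S m), C'; simpl; rewrite Hs; repeat split; [assumption|].
      transitivity (eren S (eren (fun k => S m + k) C')).
      * rewrite eren_eren; reflexivity.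
      * rewrite HC'; apply eren_after_esubst.
Qed.

Lemma ety_weaken {P} (F G : ectx P) M A :
  ewf (F ++ G) -> ety G M A ->
  ety (F ++ G) (eren (fun m => length F + m) M) (eren (fun m => length F + m) A).
Proof.
  intros HF HM; rewrite !eren_esubst; revert HF HM; apply ety_ectx_ren.
  intros n B Hn; exists (length F + n), B; repeat split.
  - rewrite nth_error_app2 by lia; replace (length F + n - length F) with n by lia; assumption.
  - rewrite eren_esubst; apply esubst_ext; intros k; f_equal; lia.
Qed.

Definition ectx_sub {P} (G D : ectx P) (sigma : nat -> eterm P) : Prop :=
  forall n A, nth_error G n = Some A ->
    ety D (sigma n) (esubst (fun m => sigma (S n + m)) A).

Lemma ety_ectx_sub {P} (G D : ectx P) sigma M A :
  ectx_sub G D sigma -> ewf D -> ety G M A -> ety D (esubst sigma M) (esubst sigma A).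
Proof.
  intros HR HD HM; revert HM D sigma HR HD; apply ety_esubst_class.
  - intros G' D sigma n B HR _ Hn; apply HR; assumption.
  - intros G' D sigma B s HR HB [|n] C HC.
    + injection HC as <-.
      change (fun m => eup sigma (1 + m)) with (fun m => eren S (sigma m)).
      rewrite <- eren_after_esubst.
      apply (ety_var (esubst sigma B :: D) 0); [eapply ewf_decl; eassumption | reflexivity].
    + change (fun m => eup sigma (S (S n) + m)) with (fun m => eren S (sigma (S n + m))).
      rewrite <- eren_after_esubst.
      apply (ety_weaken (esubst sigma B :: nil)); [eapply ewf_decl; eassumption | auto].
Qed.

Lemma ectx_sub_one {P} (G : ectx P) A N s :
  ety G A (ESort s) -> ety G N A ->
  ectx_sub (A :: G) G (fun n => match n with 0 => N | S m => EVar m end).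
Proof.
  intros HA HN [|n] C HC.
  - injection HC as <-; rewrite esubst_id; auto.
  - simpl; rewrite <- (eren_esubst C (fun m => S (n + m))).
    constructor; eauto using ety_ewf.
Qed.

Lemma ety_esubst1 {P} (G : ectx P) A B M N s :
  ety G A (ESort s) -> ety G N A -> ety (A :: G) M B ->
  ety G (esubst1 M N) (esubst1 B N).
Proof.
  intros HA HN; apply ety_ectx_sub; eauto using ectx_sub_one, ety_ewf.
Qed.

(** The identity is a typed substitution from [A :: G] to [A' :: G]: variable 0 has type [A'] there
    and is converted to [A]. *)
Lemma ety_ctx_conv {P} (G : ectx P) A A' s s' M B :
  ety G A (ESort s) -> ety G A' (ESort s') -> econv A A' ->
  ety (A :: G) M B -> ety (A' :: G) M B.
Proof.
  intros HA HA' Hconv HM.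
  assert (HD := ewf_decl _ _ _ HA').
  rewrite <- (esubst_id M EVar), <- (esubst_id B EVar) by reflexivity.
  revert HD HM; apply ety_ectx_sub; intros [|n] C HC.
  - injection HC as <-.
    apply ety_conv with (eren S A') s.
    + apply (ety_var (A' :: G) 0); [eapply ewf_decl; eassumption | reflexivity].
    + change (fun m => EVar (1 + m)) with (fun m => @EVar P (S m)).
      rewrite <- eren_esubst.
      apply (ety_weaken (A' :: nil) G A (ESort s)); [eapply ewf_decl; eassumption | auto].
    + rewrite eren_esubst; apply econv_esubst, rst_sym, Hconv.
  - rewrite <- (eren_esubst C (fun m => S (S n) + m)).
    constructor; [eapply ewf_decl; eassumption | assumption].
Qed.

(** [F] includes the variable being looked up, so that its length [S n] is exactly the shift made by
    [ety_var] and weakening by [F] yields the type of the variable. *)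
Lemma ewf_nth {P} (G : ectx P) n A : ewf G -> nth_error G n = Some A ->
  exists F G' s, G = F ++ G' /\ length F = S n /\ ety G' A (ESort s).
Proof.
  revert n; induction G as [|B G IH]; intros [|n] HG Hn; try discriminate.
  - injection Hn as ->; inversion HG; subst.
    exists (A :: nil), G, s; auto.
  - inversion HG; subst.
    destruct (IH n) as (F & G' & s' & -> & HF & HA); eauto using ety_ewf.
    exists (B :: F), G', s'; simpl; auto.
Qed.

Lemma ewf_nth_sort {P} (G : ectx P) n A : ewf G -> nth_error G n = Some A ->
  exists s, ety G (eren (fun m => S n + m) A) (ESort s).
Proof.
  intros HG Hn; destruct (ewf_nth _ _ _ HG Hn) as (F & G' & s & -> & HF & HA).
  exists s; rewrite <- HF; apply (ety_weaken F G' A (ESort s)); assumption.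
Qed.

(** Totality removes the usual exception for top-sorts: every sort is typed through [ax], and every
    product of well-sorted types through [rl]. *)
Lemma ety_type_correct {P} (HP : pts_total P) (G : ectx P) M A :
  ety G M A -> exists s, ety G A (ESort s).
Proof.
  induction 1.
  - apply ewf_nth_sort; assumption.
  - destruct (proj1 HP s2) as (s3 & ?); exists s3; constructor; assumption.
  - destruct (proj1 HP s3) as (s4 & ?); exists s4; constructor; eauto using ety_ewf.
  - destruct (proj2 HP s1 s2) as (s3 & ?); exists s3; econstructor; eassumption.
  - exists s2; apply (ety_esubst1 G A (ESort s2) B N s1); assumption.
  - exists s; assumption.
Qed.

(** Only the abstraction case keeps typing premises, used to retype the contractum of a redex.
    Elsewhere the side conditions and the type up to conversion are what uniqueness of types calls
    for. *)
Lemma ety_generation {P} (G : ectx P) M T : ety G M T ->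
  match M with
  | EVar n => exists A, nth_error G n = Some A /\ econv (eren (fun m => S n + m) A) T
  | ESort s => exists s', ax P s s' /\ econv (ESort s') T
  | EProd s1 s2 A B => exists s3, rl P s1 s2 s3 /\ econv (ESort s3) T
  | ELam s1 s2 A B N =>
      ety G A (ESort s1) /\ ety (A :: G) B (ESort s2) /\ ety (A :: G) N B /\
      econv (EProd s1 s2 A B) T
  | EApp s1 s2 A B N N' => econv (esubst1 B N') T
  end.
Proof.
  induction 1.
  - exists A; split; [assumption | apply rst_refl].
  - exists s2; split; [assumption | apply rst_refl].
  - exists s3; split; [assumption | apply rst_refl].
  - repeat split; try assumption; apply rst_refl.
  - apply rst_refl.
  - destruct M;
      repeat match goal with
             | H : exists _, _ |- _ => destruct H
             | H : _ /\ _ |- _ => destruct H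
             end;
      repeat first [ eexists | split | eassumption | eapply rst_trans; eassumption ].
Qed.

(** Annotations spell out the type of an abstraction or application, so generation alone settles
    these cases; functionality of [ax] and [rl] settles sorts and products. *)
Lemma ety_unique {P} (HP : pts_functional P) (G : ectx P) M A B :
  ety G M A -> ety G M B -> econv A B.
Proof.
  intros HA HB; apply ety_generation in HA; apply ety_generation in HB.
  destruct M as [n | s | s1 s2 C D | s1 s2 C D N | s1 s2 C D N N'].
  - destruct HA as (T & E & HT), HB as (T' & E' & HT').
    rewrite E in E'; injection E' as <-.
    eapply rst_trans; [apply rst_sym|]; eassumption.
  - destruct HA as (T & E & HT), HB as (T' & E' & HT').
    rewrite (proj1 HP _ _ _ E E') in HT.
    eapply rst_trans; [apply rst_sym|]; eassumption.
  - destruct HA as (T & E & HT), HB as (T' & E' & HT').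
    rewrite (proj2 HP _ _ _ _ E E') in HT.
    eapply rst_trans; [apply rst_sym|]; eassumption.
  - eapply rst_trans; [apply rst_sym; apply HA | apply HB].
  - eapply rst_trans; [apply rst_sym|]; eassumption.
Qed.

Lemma ety_unique_sort {P} (HP : pts_functional P) (G : ectx P) M s s' :
  ety G M (ESort s) -> ety G M (ESort s') -> s = s'.
Proof. intros H H'; apply econv_sort_inj; eapply ety_unique; eassumption. Qed.

(** A step inside an annotation changes the type that the rules assign, and sometimes the context of
    other premises. Each such case retypes the premises by conversion and then converts the result
    back to the original type. *)
Lemma subject_reduction {P} (HP : pts_total P) (G : ectx P) M A :
  ety G M A -> forall M', estep M M' -> ety G M' A.
Proof.
  assert (prod_sort : forall (G : ectx P) s1 s2 A B, ety G A (ESort s1) ->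
             ety (A :: G) B (ESort s2) -> exists s, ety G (EProd s1 s2 A B) (ESort s)).
  { intros; destruct (proj2 HP s1 s2) as (s3 & ?); exists s3; econstructor; eassumption. }
  assert (ctx_step : forall (G : ectx P) A A' s M B, ety G A (ESort s) ->
             ety G A' (ESort s) -> estep A A' -> ety (A :: G) M B -> ety (A' :: G) M B).
  { intros G0 A0 A' s M0 B HA HA' HAA' HM; revert HM.
    apply (ety_ctx_conv _ _ _ s s); auto; apply rst_step; assumption. }
  induction 1 as [| | G s1 s2 s3 A B HA IHA HB IHB Hr | G s1 s2 A B M HA IHA HB IHB HM IHM
                  | G s1 s2 A B M N HA IHA HB IHB HN IHN HM IHM | ];
    intros M' Hstep.
  - inversion Hstep.
  - inversion Hstep.
  - inversion Hstep; subst; econstructor; eauto.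
  - destruct (prod_sort _ _ _ _ _ HA HB) as (s3 & HAB).
    inversion Hstep; subst.
    + apply ety_conv with (EProd s1 s2 A' B) s3; auto.
      * constructor; eauto.
      * apply rst_sym, rst_step; constructor; assumption.
    + apply ety_conv with (EProd s1 s2 A B') s3; auto.
      * constructor; auto; eapply ety_conv; eauto; apply rst_step; assumption.
      * apply rst_sym, rst_step; constructor; assumption.
    + constructor; auto.
  - inversion Hstep; subst.
    (* The annotations [A'], [B'] of the abstraction need only be convertible to [A], [B]. The
       argument is moved to type [A'], the body is substituted at type [B'], and the result is
       converted to [B]. *)
    + destruct (ety_generation _ _ _ HM) as (HA' & HB' & HM0 & Hconv).
      apply econv_prod_inj in Hconv; destruct Hconv as [HcA HcB].
      apply ety_conv with (esubst1 B' N) s2.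
      * eapply ety_esubst1; [exact HA' | | eassumption].
        eapply ety_conv; [eassumption | exact HA' | apply rst_sym, HcA].
      * exact (ety_esubst1 _ _ (ESort s2) _ _ _ HA HN HB).
      * apply econv_esubst; assumption.
    + assert (HB' : ety (A' :: G) B (ESort s2)).
      { eauto. }
      destruct (prod_sort _ _ _ _ _ (IHA _ ltac:(eassumption)) HB') as (s3 & HAB).
      constructor; auto.
      * eapply ety_conv; eauto; apply rst_step; assumption.
      * eapply ety_conv; eauto; apply rst_step; constructor; assumption.
    + destruct (prod_sort _ _ _ _ _ HA (IHB _ ltac:(eassumption))) as (s3 & HAB).
      apply ety_conv with (esubst1 B' N) s2.
      * constructor; auto.
        eapply ety_conv; eauto; apply rst_step; constructor; assumption.
      * exact (ety_esubst1 _ _ (ESort s2) _ _ _ HA HN HB).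
      * apply rst_sym, econv_esubst, rst_step; assumption.
    + constructor; auto.
    + apply ety_conv with (esubst1 B N') s2.
      * constructor; auto.
      * exact (ety_esubst1 _ _ (ESort s2) _ _ _ HA HN HB).
      (* One step of [N] may be copied or erased in [B{N/x}]; a parallel step absorbs all copies at
         once. *)
      * apply rst_sym, esteps_econv, epar_esteps, epar_esubst1;
          [apply epar_refl | apply estep_epar; assumption].
  - econstructor; eauto.
Qed.

Lemma ety_epars {P} (HP : pts_total P) (G : ectx P) M M' A :
  epars M M' -> ety G M A -> ety G M' A.
Proof.
  induction 1 as [|M M1 M' H1 _ IH]; auto.
  intros HM; apply IH; clear IH; apply epar_esteps in H1; revert HM.
  induction H1; eauto using subject_reduction.
Qed.

(** Subject reduction carries both sorts to a common reduct, where uniqueness of types compares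
    them. This keeps the first index of [dEl] fixed across the conversion rule. *)
Lemma econv_unique_sort {P} (HP : pts_functional P) (HP' : pts_total P)
    (G : ectx P) A B s s' :
  econv A B -> ety G A (ESort s) -> ety G B (ESort s') -> s = s'.
Proof.
  intros (Q & HA & HB)%church_rosser HAs HBs.
  apply (ety_unique_sort HP G Q);
    [exact (ety_epars HP' _ _ _ _ HA HAs) | exact (ety_epars HP' _ _ _ _ HB HBs)].
Qed.

(** * Substitution in Dedukti terms *)

(** The arguments of a constant are nested in a vector; this principle provides induction hypotheses
    for them too. *)
Lemma dterm_nested_ind L (Q : dterm L -> Prop)
    (Q_var : forall n, Q (DVar n))
    (Q_cst : forall c args, Vector.Forall Q args -> Q (DCst c args))
    (Q_type : Q DType) (Q_kind : Q DKind)
    (Q_pi : forall A B, Q A -> Q B -> Q (DPi A B))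
    (Q_lam : forall A M, Q A -> Q M -> Q (DLam A M))
    (Q_app : forall M N, Q M -> Q N -> Q (DApp M N)) :
  forall t, Q t.
Proof.
  fix IH 1; intros [n | c args | | | A B | A M | M N];
    [apply Q_var | apply Q_cst | apply Q_type | apply Q_kind
    | apply Q_pi | apply Q_lam | apply Q_app]; try apply IH.
  induction args; constructor; [apply IH | assumption].
Qed.

Lemma Vector_map_Forall {X Y} (f g : X -> Y) n (v : Vector.t X n) :
  Vector.Forall (fun x => f x = g x) v -> Vector.map f v = Vector.map g v.
Proof. induction 1; simpl; congruence. Qed.

Lemma dsubst_ext {L} (t : dterm L) : forall sigma tau,
  (forall n, sigma n = tau n) -> dsubst sigma t = dsubst tau t.
Proof.
  induction t as [| c args IH | | | | |] using dterm_nested_ind;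
    intros sigma tau eq; simpl; f_equal; auto.
  1: apply Vector_map_Forall; revert IH; apply Vector.Forall_impl; auto.
  all: match goal with H : context [dsubst _ ?t = _] |- dsubst _ ?t = _ => apply H end;
    intros [|n]; simpl; congruence.
Qed.

Lemma dren_dsubst {L} (t : dterm L) :
  forall xi, dren xi t = dsubst (fun n => DVar (xi n)) t.
Proof.
  induction t as [| c args IH | | | | |] using dterm_nested_ind;
    intros xi; simpl; f_equal; auto.
  1: apply Vector_map_Forall; revert IH; apply Vector.Forall_impl; auto.
  all: match goal with H : context [dren _ ?t = _] |- dren _ ?t = _ => rewrite H end;
    apply dsubst_ext; intros [|n]; reflexivity.
Qed.

Lemma dsubst_dren {L} (t : dterm L) : forall xi sigma,
  dsubst sigma (dren xi t) = dsubst (fun n => sigma (xi n)) t.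
Proof.
  induction t as [| c args IH | | | | |] using dterm_nested_ind;
    intros xi sigma; simpl; f_equal; auto.
  1: rewrite Vector.map_map; apply Vector_map_Forall; revert IH;
    apply Vector.Forall_impl; auto.
  all: match goal with H : context [dren _ ?t] |- context [dren _ ?t] => rewrite H end;
    apply dsubst_ext; intros [|n]; reflexivity.
Qed.

Lemma dren_dren {L} (t : dterm L) xi zeta :
  dren zeta (dren xi t) = dren (fun n => zeta (xi n)) t.
Proof. rewrite (dren_dsubst (dren xi t)), dsubst_dren, dren_dsubst; reflexivity. Qed.

Lemma dren_after_dsubst {L} (t : dterm L) : forall sigma xi,
  dren xi (dsubst sigma t) = dsubst (fun n => dren xi (sigma n)) t.
Proof.
  induction t as [| c args IH | | | | |] using dterm_nested_ind;
    intros sigma xi; simpl; f_equal; auto.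
  1: rewrite Vector.map_map; apply Vector_map_Forall; revert IH;
    apply Vector.Forall_impl; auto.
  all: match goal with
       | H : context [dsubst _ ?t] |- context [dren _ (dsubst _ ?t)] => rewrite H
       end;
    apply dsubst_ext; intros [|n]; simpl; rewrite ?dren_dren; reflexivity.
Qed.

Lemma dsubst_dsubst {L} (t : dterm L) : forall sigma tau,
  dsubst tau (dsubst sigma t) = dsubst (fun n => dsubst tau (sigma n)) t.
Proof.
  induction t as [| c args IH | | | | |] using dterm_nested_ind;
    intros sigma tau; simpl; f_equal; auto.
  1: rewrite Vector.map_map; apply Vector_map_Forall; revert IH;
    apply Vector.Forall_impl; auto.
  all: match goal with
       | H : context [dsubst _ ?t] |- context [dsubst _ (dsubst _ ?t)] => rewrite H
       end;
    apply dsubst_ext; intros [|n]; simpl;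
    rewrite ?dsubst_dren, ?dren_after_dsubst; reflexivity.
Qed.

Lemma dsubst_id {L} (t : dterm L) : forall sigma,
  (forall n, sigma n = DVar n) -> dsubst sigma t = t.
Proof.
  induction t as [| c args IH | | | | |] using dterm_nested_ind;
    intros sigma eq; simpl; f_equal; auto.
  1: transitivity (Vector.map (fun x => x) args);
    [apply Vector_map_Forall; revert IH; apply Vector.Forall_impl; auto | apply Vector.map_id].
  all: match goal with H : context [dsubst _ ?t = _] |- dsubst _ ?t = _ => apply H end;
    intros [|n]; simpl; rewrite ?eq; reflexivity.
Qed.

Lemma dsubst_dsubst1 {L} (B N : dterm L) sigma :
  dsubst sigma (dsubst1 B N) = dsubst1 (dsubst (dup sigma) B) (dsubst sigma N).
Proof.
  unfold dsubst1; rewrite !dsubst_dsubst; apply dsubst_ext; intros [|n]; simpl;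
    rewrite ?dsubst_dren; [|rewrite dsubst_id]; reflexivity.
Qed.

(** This computes the beta contractum of a weakened abstraction applied to the fresh variable, the
    form in which the type family of [dabs] is used. *)
Lemma dsubst1_dren_up {L} (t : dterm L) : dsubst1 (dren (up_ren S) t) (DVar 0) = t.
Proof.
  unfold dsubst1; rewrite dsubst_dren; apply dsubst_id; intros [|n]; reflexivity.
Qed.

(* Semantic form of "the free variables of [t] are below [k]". *)
Definition dscoped {L} (k : nat) (t : dterm L) : Prop :=
  forall sigma tau, (forall n, n < k -> sigma n = tau n) -> dsubst sigma t = dsubst tau t.

Lemma dscoped_dup {L} k (sigma tau : nat -> dterm L) :
  (forall n, n < k -> sigma n = tau n) -> forall n, n < S k -> dup sigma n = dup tau n.
Proof. intros eq [|n] Hn; simpl; [|rewrite eq by lia]; reflexivity. Qed.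

(** Out of range, [dinst] falls back on a variable that [sigma] would act on from the left-hand side
    only; hence the bound, and scopedness in [dsubst_dinst]. *)
Lemma dinst_dsubst {L} (Ms : list (dterm L)) sigma n : n < length Ms ->
  dsubst sigma (dinst Ms n) = dinst (map (dsubst sigma) Ms) n.
Proof.
  intros Hn; unfold dinst.
  rewrite <- map_rev, <- (map_nth (dsubst sigma)); apply nth_indep.
  rewrite length_map, length_rev; assumption.
Qed.

Lemma dsubst_dinst {L} (Ms : list (dterm L)) sigma t : dscoped (length Ms) t ->
  dsubst sigma (dsubst (dinst Ms) t) = dsubst (dinst (map (dsubst sigma) Ms)) t.
Proof.
  intros Ht; rewrite dsubst_dsubst; apply Ht; apply dinst_dsubst.
Qed.

(** * Conversion in Dedukti *)

Lemma Vector_map_replace {X Y} (f : X -> Y) n (v : Vector.t X n) i x :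
  Vector.map f (Vector.replace v i x) = Vector.replace (Vector.map f v) i (f x).
Proof.
  revert i; induction v; intros i; [inversion i|].
  pattern i; apply (Fin.caseS' i); simpl; [reflexivity | intros p; f_equal; auto].
Qed.

(** Applying [tau] to an instance of a rule gives the instance for the composed substitution. *)
Lemma dstep_dsubst {L} (T : theory L) M N : dstep T M N ->
  forall sigma, dstep T (dsubst sigma M) (dsubst sigma N).
Proof.
  induction 1; intros tau; simpl dsubst; try (constructor; auto; fail).
  - rewrite dsubst_dsubst1; constructor.
  - change (dstep T (dsubst tau (dsubst sigma (DCst (rule_cst r) (rule_args r))))
                    (dsubst tau (dsubst sigma (rule_rhs r)))).
    rewrite !dsubst_dsubst; apply dstep_rule; assumption.
  - rewrite Vector_map_replace; constructor.
    erewrite Vector.nth_map; [|reflexivity]; auto.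
Qed.

Lemma dconv_map {L} (T : theory L) (C : dterm L -> dterm L) :
  (forall M N, dstep T M N -> dstep T (C M) (C N)) ->
  forall M N, dconv T M N -> dconv T (C M) (C N).
Proof.
  intros HC; induction 1; [apply rst_step; auto | apply rst_refl | apply rst_sym; auto |
                           eapply rst_trans; eauto].
Qed.

Lemma dconv_dsubst {L} (T : theory L) M N sigma :
  dconv T M N -> dconv T (dsubst sigma M) (dsubst sigma N).
Proof. apply dconv_map; intros; apply dstep_dsubst; assumption. Qed.

(** Arguments are converted one at a time from the left. The induction ranges over all contexts [C],
    so that the entries already converted can be absorbed into [C]. *)
Lemma dconv_vector {L} (T : theory L) n (v w : Vector.t (dterm L) n) :
  Vector.Forall2 (dconv T) v w ->
  forall C : Vector.t (dterm L) n -> dterm L,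
  (forall u i M, dstep T (Vector.nth u i) M -> dstep T (C u) (C (Vector.replace u i M))) ->
  dconv T (C v) (C w).
Proof.
  induction 1 as [|n a b v w Hab _ IH]; intros C HC; [apply rst_refl|].
  apply rst_trans with (C (Vector.cons _ b _ v)).
  - revert Hab; apply (dconv_map T (fun x => C (Vector.cons _ x _ v))).
    intros M N HMN; exact (HC (Vector.cons _ M _ v) Fin.F1 N HMN).
  - apply (IH (fun u => C (Vector.cons _ b _ u))).
    intros u i M HM; exact (HC (Vector.cons _ b _ u) (Fin.FS i) M HM).
Qed.

Lemma dconv_cst {L} (T : theory L) c v w :
  Vector.Forall2 (dconv T) v w -> dconv T (DCst c v) (DCst c w).
Proof. intros H; apply (dconv_vector T _ v w H); constructor; assumption. Qed.

Lemma dconv_lam {L} (T : theory L) A A' M M' :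
  dconv T A A' -> dconv T M M' -> dconv T (DLam A M) (DLam A' M').
Proof.
  intros HA HM; apply rst_trans with (DLam A' M).
  - revert HA; apply (dconv_map T (fun A => DLam A M)); constructor; assumption.
  - revert HM; apply (dconv_map T (DLam A')); constructor; assumption.
Qed.

(** * Metatheory of Dedukti typing *)

Lemma dty_dwf {L} (T : theory L) G M A : dty T G M A -> dwf T G.
Proof. induction 1; auto. Qed.

Lemma dty_scoped {L} (T : theory L) G M A : dty T G M A -> dscoped (length G) M.
Proof.
  induction 1 as [| | G c args s _ _ _ _ _ IH | | | |]; intros sigma tau eq; simpl;
    try (solve [eauto | f_equal; eauto using dscoped_dup]).
  - apply eq, nth_error_Some; congruence.
  - f_equal; apply Vector_map_Forall, Vector.to_list_Forall, Forall_forall.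
    intros M HM; apply In_nth_error in HM as (i & Hi).
    (* The premise of [dty_cst] concerns positions present in both vectors; as their lengths agree,
       it reaches every argument. *)
    destruct (nth_error (Vector.to_list (decl_ctx T c)) i) as [A|] eqn:HA;
      [exact (IH i M A Hi HA sigma tau eq)|].
    apply nth_error_None in HA; rewrite Vector.length_to_list in HA.
    assert (Hlt : i < length (Vector.to_list args)) by (apply nth_error_Some; congruence).
    rewrite Vector.length_to_list in Hlt; lia.
Qed.

(** [Ts] is in the order of [decl_ctx], oldest first, so the induction peels off its last entry, the
    head of the reversed context. *)
Lemma dwf_rev_scoped {L} (T : theory L) Ts : dwf T (rev Ts) ->
  forall i A, nth_error Ts i = Some A -> dscoped i A.
Proof.
  induction Ts as [|B Ts IH] using rev_ind; intros HT i A Hi.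
  - destruct i; discriminate.
  - rewrite rev_app_distr in HT; simpl in HT.
    inversion HT as [|G C HB]; subst.
    destruct (PeanoNat.Nat.lt_ge_cases i (length Ts)) as [Hlt|Hge].
    + rewrite nth_error_app1 in Hi by assumption; eauto using dty_dwf.
    + rewrite nth_error_app2 in Hi by assumption.
      destruct (i - length Ts) as [|k] eqn:E; simpl in Hi.
      * injection Hi as <-; apply dty_scoped in HB; rewrite length_rev in HB.
        replace i with (length Ts) by lia; assumption.
      * destruct k; discriminate.
Qed.

(** As for the EPTS, [R] stands first for renamings and then for typed substitutions. The new case
    is that of constants, where substitution must commute with the instantiation of declared
    types. *)
Lemma dty_dsubst_class {L} (T : theory L)
    (R : dctx L -> dctx L -> (nat -> dterm L) -> Prop)
    (R_var : forall G D sigma n A, R G D sigma -> dwf T D -> nth_error G n = Some A ->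
       dty T D (sigma n) (dsubst (fun m => sigma (S n + m)) A))
    (R_up : forall G D sigma A, R G D sigma -> dty T D (dsubst sigma A) DType ->
       R (A :: G) (dsubst sigma A :: D) (dup sigma))
    G M A : dty T G M A ->
  forall D sigma, R G D sigma -> dwf T D -> dty T D (dsubst sigma M) (dsubst sigma A).
Proof.
  assert (sort_subst : forall s sigma, @dsort L s -> dsubst sigma s = s).
  { intros s sigma [-> | ->]; reflexivity. }
  induction 1 as [G n A HG Hn | G HG | G c args s HG Hd IHd Hs Hargs IHargs
                  | G A B s HA IHA HB IHB Hs | G A B M s HA IHA HB IHB Hs HM IHM
                  | G A B M N HM IHM HN IHN | G M A B s HM IHM HB IHB Hs Hconv];
    intros D sigma HR HD.
  - rewrite dsubst_dren; simpl; eauto.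
  - constructor; assumption.
  - rewrite dsubst_dinst.
    2: { apply dty_scoped in Hd; rewrite length_rev, Vector.length_to_list in Hd.
         rewrite Vector.length_to_list; assumption. }
    rewrite <- Vector.to_list_map.
    apply (dty_cst T D c (Vector.map (dsubst sigma) args) s); auto.
    intros i M A HM HA.
    rewrite Vector.to_list_map in HM |- *; rewrite nth_error_map in HM.
    destruct (nth_error (Vector.to_list args) i) as [M0|] eqn:HM0; [|discriminate].
    injection HM as <-.
    (* The type of parameter [i] is scoped over the [i] parameters before it, and [firstn i] has
       length exactly [i] because [i] is in range. *)
    rewrite firstn_map, <- dsubst_dinst; [eauto|].
    rewrite length_firstn, PeanoNat.Nat.min_l.
    + eapply dwf_rev_scoped; eauto using dty_dwf.
    + apply PeanoNat.Nat.lt_le_incl, nth_error_Some; congruence.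
  - specialize (IHA _ _ HR HD); rewrite (sort_subst s) by assumption; simpl.
    constructor; auto.
    rewrite <- (sort_subst s (dup sigma)) by assumption; auto using dwf_decl.
  - specialize (IHA _ _ HR HD).
    assert (HRA := R_up _ _ _ _ HR IHA); assert (HDA := dwf_decl _ _ _ IHA).
    apply dty_abs with s; auto.
    rewrite <- (sort_subst s (dup sigma)) by assumption; auto.
  - rewrite dsubst_dsubst1; econstructor; [apply (IHM _ _ HR HD) | auto].
  - apply dty_conv with (dsubst sigma A) s; auto using dconv_dsubst.
    rewrite <- (sort_subst s sigma) by assumption; auto.
Qed.

Definition dctx_ren {L} (G D : dctx L) (sigma : nat -> dterm L) : Prop :=
  forall n A, nth_error G n = Some A -> exists m A',
    sigma n = DVar m /\ nth_error D m = Some A' /\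
    dren (fun k => S m + k) A' = dsubst (fun k => sigma (S n + k)) A.

Lemma dty_dctx_ren {L} (T : theory L) G D sigma M A :
  dctx_ren G D sigma -> dwf T D -> dty T G M A ->
  dty T D (dsubst sigma M) (dsubst sigma A).
Proof.
  intros HR HD HM; revert HM D sigma HR HD; apply dty_dsubst_class.
  - intros G' D sigma n B HR HD Hn.
    destruct (HR _ _ Hn) as (m & B' & -> & Hm & <-); constructor; assumption.
  - intros G' D sigma B HR _ [|n] C HC.
    + injection HC as <-.
      exists 0, (dsubst sigma B); repeat split; apply dren_after_dsubst.
    + destruct (HR _ _ HC) as (m & C' & Hs & Hm & HC').
      exists (S m), C'; simpl; rewrite Hs; repeat split; [assumption|].
      transitivity (dren S (dren (fun k => S m + k) C')).
      * rewrite dren_dren; reflexivity.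
      * rewrite HC'; apply dren_after_dsubst.
Qed.

Lemma dty_weaken {L} (T : theory L) G B M A :
  dty T G B DType -> dty T G M A -> dty T (B :: G) (dren S M) (dren S A).
Proof.
  intros HB HM; rewrite !dren_dsubst; revert HM.
  apply dty_dctx_ren; [|apply dwf_decl; assumption].
  intros n C Hn; exists (S n), C; repeat split; [assumption | apply dren_dsubst].
Qed.

Lemma dty_weaken_nil {L} (T : theory L) D M A : dwf T D -> dty T nil M A -> dty T D M A.
Proof.
  intros HD HM.
  rewrite <- (dsubst_id M DVar), <- (dsubst_id A DVar) by reflexivity.
  revert HD HM; apply dty_dctx_ren; intros [|n] C Hn; discriminate.
Qed.

Lemma dty_dsubst1 {L} (T : theory L) G A B M N :
  dty T G N A -> dty T (A :: G) M B -> dty T G (dsubst1 M N) (dsubst1 B N).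
Proof.
  intros HN HM; assert (HG := dty_dwf _ _ _ _ HN); unfold dsubst1.
  set (R := fun G D sigma => forall n A, nth_error G n = Some A ->
              dty T D (sigma n) (dsubst (fun m => sigma (S n + m)) A)).
  refine (dty_dsubst_class T R _ _ _ _ _ HM _ _ _ HG).
  - intros G' D sigma n C HR _ Hn; apply HR; assumption.
  - intros G' D sigma C HR HC [|n] E HE.
    + injection HE as <-.
      change (fun m => dup sigma (1 + m)) with (fun m => dren S (sigma m)).
      rewrite <- dren_after_dsubst.
      apply (dty_var T (dsubst sigma C :: D) 0); [apply dwf_decl; assumption | reflexivity].
    + change (fun m => dup sigma (S (S n) + m)) with (fun m => dren S (sigma (S n + m))).
      rewrite <- dren_after_dsubst.
      apply dty_weaken; [assumption | apply HR; assumption].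
  - intros [|n] C HC.
    + injection HC as <-; rewrite dsubst_id; auto.
    + simpl; rewrite <- (dren_dsubst C (fun m => S (n + m))); constructor; assumption.
Qed.

(** * The constants of the encoding *)

Section Encoding.
Context {P : pts_spec} (K : completion P).
Local Notation T := (stheory K).
Local Notation tm := (dterm (slang (ext_lang K))).

(** Runs through the argument positions of [dty_cst]; at each one the declared type, instantiated by
    the earlier arguments, computes to the type found in a hypothesis. *)
Local Ltac args :=
  let i := fresh "i" in
  let HM := fresh in let HA := fresh in
  intros i ? ? HM HA;
  repeat (destruct i as [|i];
    [simpl in HM, HA; injection HM as <-; injection HA as <-; try assumption|]);
  try (destruct i; discriminate).

Local Ltac var n :=
  lazymatch goal with
  | |- dty ?T ?G _ _ =>
      let H := fresh in
      assert (H : dwf T G) by assumption;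
      exact (dty_var T G n _ H eq_refl)
  end.

(** Here and for the later constants, the first goal left by [dty_cst] is that the declared type is
    itself well-sorted over its parameters. *)
Lemma dty_hatS D : dwf T D -> dty T D hatS DType.
Proof.
  intros HD; refine (dty_cst T D KS (Vector.nil _) DKind HD _ _ _).
  - apply dty_sort, dwf_empty.
  - right; reflexivity.
  - args.
Qed.

Lemma dwf_hatS D : dwf T D -> dwf T (hatS :: D).
Proof. intros HD; apply dwf_decl, dty_hatS, HD. Qed.

Lemma dwf_s1 : dwf T (hatS :: nil).
Proof. apply dwf_hatS, dwf_empty. Qed.

Lemma dwf_s2 : dwf T (hatS :: hatS :: nil).
Proof. apply dwf_hatS, dwf_s1. Qed.

Lemma dty_hatA D s : dty T D s hatS -> dty T D (hatA s) hatS.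
Proof.
  intros Hs; assert (HD := dty_dwf _ _ _ _ Hs).
  refine (dty_cst T D KA (Vector.cons _ s _ (Vector.nil _)) DType HD _ _ _).
  - apply dty_hatS, dwf_s1.
  - left; reflexivity.
  - args.
Qed.

Lemma dty_hatR D s1 s2 : dty T D s1 hatS -> dty T D s2 hatS -> dty T D (hatR s1 s2) hatS.
Proof.
  intros Hs1 Hs2; assert (HD := dty_dwf _ _ _ _ Hs1).
  refine (dty_cst T D KR (Vector.cons _ s1 _ (Vector.cons _ s2 _ (Vector.nil _)))
            DType HD _ _ _).
  - apply dty_hatS, dwf_s2.
  - left; reflexivity.
  - args.
Qed.

Lemma dty_dU D s : dty T D s hatS -> dty T D (dU s) DType.
Proof.
  intros Hs; assert (HD := dty_dwf _ _ _ _ Hs).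
  refine (dty_cst T D KU (Vector.cons _ s _ (Vector.nil _)) DKind HD _ _ _).
  - apply dty_sort, dwf_s1.
  - right; reflexivity.
  - args.
Qed.

Lemma dty_dEl D s A : dty T D s hatS -> dty T D A (dU s) -> dty T D (dEl s A) DType.
Proof.
  intros Hs HA; assert (HD := dty_dwf _ _ _ _ Hs).
  refine (dty_cst T D KEl (Vector.cons _ s _ (Vector.cons _ A _ (Vector.nil _)))
            DKind HD _ _ _).
  - apply dty_sort, dwf_decl, dty_dU.
    assert (H := dwf_s1); var 0.
  - right; reflexivity.
  - args.
Qed.

Lemma dty_du D s : dty T D s hatS -> dty T D (du s) (dU (hatA s)).
Proof.
  intros Hs; assert (HD := dty_dwf _ _ _ _ Hs).
  refine (dty_cst T D Ku (Vector.cons _ s _ (Vector.nil _)) DType HD _ _ _).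
  - apply dty_dU, dty_hatA; assert (H := dwf_s1); var 0.
  - left; reflexivity.
  - args.
Qed.

(* The context [s1 : hatS, s2 : hatS, A : U s1], extended in [ctx_AB] by
   [B : El s1 A -> U s2]. *)
Definition ctx_A : dctx (slang (ext_lang K)) := dU (DVar 1) :: hatS :: hatS :: nil.

Definition ctx_AB : dctx (slang (ext_lang K)) :=
  DPi (dEl (DVar 2) (DVar 0)) (dU (DVar 2)) :: ctx_A.

Lemma dwf_ctx_A : dwf T ctx_A.
Proof. apply dwf_decl, dty_dU; assert (H := dwf_s2); var 1. Qed.

Lemma dwf_ctx_AB : dwf T ctx_AB.
Proof.
  assert (H := dwf_ctx_A).
  assert (HEl : dty T ctx_A (dEl (DVar 2) (DVar 0)) DType).
  { apply dty_dEl; [var 2 | var 0]. }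
  assert (H' := dwf_decl _ _ _ HEl).
  apply dwf_decl, dty_prod; [assumption | apply dty_dU; var 2 | left; reflexivity].
Qed.

(** The arrow type of [B] is a product with a vacuous binder, whence the shift of [s2]. *)
Lemma dty_dProd D s1 s2 A B :
  dty T D s1 hatS -> dty T D s2 hatS -> dty T D A (dU s1) ->
  dty T D B (DPi (dEl s1 A) (dU (dren S s2))) ->
  dty T D (dProd s1 s2 A B) (dU (hatR s1 s2)).
Proof.
  intros Hs1 Hs2 HA HB; assert (HD := dty_dwf _ _ _ _ Hs1).
  refine (dty_cst T D KProd (Vector.cons _ s1 _ (Vector.cons _ s2 _ (Vector.cons _ A _
            (Vector.cons _ B _ (Vector.nil _))))) DType HD _ _ _).
  - assert (H := dwf_ctx_AB).
    change (dty T ctx_AB (dU (hatR (DVar 3) (DVar 2))) DType).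
    apply dty_dU, dty_hatR; [var 3 | var 2].
  - left; reflexivity.
  - args.
Qed.

Lemma dty_dabs D s1 s2 A B N :
  dty T D s1 hatS -> dty T D s2 hatS -> dty T D A (dU s1) ->
  dty T D B (DPi (dEl s1 A) (dU (dren S s2))) ->
  dty T D N (DPi (dEl s1 A) (dEl (dren S s2) (DApp (dren S B) (DVar 0)))) ->
  dty T D (dabs s1 s2 A B N) (dEl (hatR s1 s2) (dProd s1 s2 A B)).
Proof.
  intros Hs1 Hs2 HA HB HN; assert (HD := dty_dwf _ _ _ _ Hs1).
  refine (dty_cst T D Kabs (Vector.cons _ s1 _ (Vector.cons _ s2 _ (Vector.cons _ A _
            (Vector.cons _ B _ (Vector.cons _ N _ (Vector.nil _)))))) DType HD _ _ _).
  - assert (H := dwf_ctx_AB).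
    assert (HEl : dty T ctx_AB (dEl (DVar 3) (DVar 1)) DType).
    { apply dty_dEl; [var 3 | var 1]. }
    assert (H1 := dwf_decl _ _ _ HEl).
    set (N_ty := DPi (dEl (DVar 3) (DVar 1)) (dEl (DVar 3) (DApp (DVar 1) (DVar 0))) : tm).
    assert (HN_ty : dwf T (N_ty :: ctx_AB)).
    { apply dwf_decl, dty_prod; [assumption | apply dty_dEl; [var 3|] | left; reflexivity].
      (* [DVar 4] is [s1] in the domain but [s2] in the codomain, which lies under one more
         binder. *)
      refine (dty_app T _ (dEl (DVar 4) (DVar 2)) (dU (DVar 4)) _ _ _ _); [var 1 | var 0]. }
    change (dty T (N_ty :: ctx_AB)
              (dEl (hatR (DVar 4) (DVar 3)) (dProd (DVar 4) (DVar 3) (DVar 2) (DVar 1))) DType).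
    apply dty_dEl; [apply dty_hatR; [var 4 | var 3] |].
    apply dty_dProd; [var 4 | var 3 | var 2 | var 1].
  - left; reflexivity.
  - args.
Qed.

Lemma dty_dapp D s1 s2 A B M N :
  dty T D s1 hatS -> dty T D s2 hatS -> dty T D A (dU s1) ->
  dty T D B (DPi (dEl s1 A) (dU (dren S s2))) ->
  dty T D M (dEl (hatR s1 s2) (dProd s1 s2 A B)) -> dty T D N (dEl s1 A) ->
  dty T D (dapp s1 s2 A B M N) (dEl s2 (DApp B N)).
Proof.
  intros Hs1 Hs2 HA HB HM HN; assert (HD := dty_dwf _ _ _ _ Hs1).
  refine (dty_cst T D Kapp (Vector.cons _ s1 _ (Vector.cons _ s2 _ (Vector.cons _ A _
            (Vector.cons _ B _ (Vector.cons _ M _ (Vector.cons _ N _ (Vector.nil _)))))))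
            DType HD _ _ _).
  - assert (H := dwf_ctx_AB).
    set (M_ty := dEl (hatR (DVar 3) (DVar 2)) (dProd (DVar 3) (DVar 2) (DVar 1) (DVar 0)) : tm).
    assert (HM_ty : dwf T (M_ty :: ctx_AB)).
    { apply dwf_decl, dty_dEl; [apply dty_hatR; [var 3 | var 2] |].
      apply dty_dProd; [var 3 | var 2 | var 1 | var 0]. }
    assert (HN_ty : dwf T (dEl (DVar 4) (DVar 2) :: M_ty :: ctx_AB)).
    { apply dwf_decl, dty_dEl; [var 4 | var 2]. }
    change (dty T (dEl (DVar 4) (DVar 2) :: M_ty :: ctx_AB)
              (dEl (DVar 4) (DApp (DVar 2) (DVar 0))) DType).
    apply dty_dEl; [var 4 |].
    refine (dty_app T _ (dEl (DVar 5) (DVar 3)) (dU (DVar 5)) _ _ _ _); [var 2 | var 0].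
  - left; reflexivity.
  - args.
Qed.

Lemma dconv_dU s s' : dconv T s s' -> dconv T (dU s) (dU s').
Proof. intros; apply dconv_cst; repeat apply Vector.Forall2_cons; auto; constructor. Qed.

Lemma dconv_dEl s s' A A' :
  dconv T s s' -> dconv T A A' -> dconv T (dEl s A) (dEl s' A').
Proof. intros; apply dconv_cst; repeat apply Vector.Forall2_cons; auto; constructor. Qed.

Lemma dconv_dEl_du s s' : dconv T (dEl s' (du s)) (dU s).
Proof.
  apply rst_step.
  apply (dstep_rule T rule_El (fun n => match n with 0 => s | _ => s' end)).
  left; reflexivity.
Qed.

Lemma dconv_dapp_dabs s1 s2 A B s1' s2' A' B' M N :
  dconv T (dapp s1 s2 A B (dabs s1' s2' A' B' M) N) (DApp M N).
Proof.
  apply rst_step.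
  (* The list follows the indices 0 to 9, hence reverses the order in which the rule names its
     variables; the default [N] is never reached by them. *)
  apply (dstep_rule T rule_app
           (fun n => nth n (N :: M :: B' :: A' :: s2' :: s1' :: B :: A :: s2 :: s1 :: nil) N)).
  right; left; reflexivity.
Qed.

(** * The translation *)

Context (P_functional : pts_functional P) (P_total : pts_total P)
  (K_sorts : represents_sorts K).

Lemma dot_dty_nil s : dty T nil (dot K s) hatS.
Proof. apply (proj1 K_sorts (dot K s)); eauto. Qed.

Lemma dot_dty D s : dwf T D -> dty T D (dot K s) hatS.
Proof. intros HD; apply dty_weaken_nil; [assumption | apply dot_dty_nil]. Qed.

(** Representations are typable in the empty context, hence closed. *)
Lemma dsubst_dot sigma s : dsubst sigma (dot K s) = dot K s.
Proof.
  rewrite <- (dsubst_id (dot K s) DVar) at 2 by reflexivity.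
  apply (dty_scoped _ _ _ _ (dot_dty_nil s)); simpl; lia.
Qed.

Lemma dren_dot xi s : dren xi (dot K s) = dot K s.
Proof. rewrite dren_dsubst; apply dsubst_dot. Qed.

Lemma ax_dconv s1 s2 : ax P s1 s2 -> dconv T (hatA (dot K s1)) (dot K s2).
Proof. apply K_sorts. Qed.

Lemma rl_dconv s1 s2 s3 : rl P s1 s2 s3 -> dconv T (hatR (dot K s1) (dot K s2)) (dot K s3).
Proof. apply K_sorts. Qed.

Local Ltac unfold_cst :=
  unfold dProd, dabs, dapp, du, dEl; cbn [dren dsubst Vector.map];
  rewrite ?dren_dot, ?dsubst_dot.

Lemma tr_eren (t : eterm P) : forall xi, tr K (eren xi t) = dren xi (tr K t).
Proof.
  induction t; intros xi; simpl; unfold_cst; repeat (f_equal; auto).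
Qed.

Lemma tr_esubst (t : eterm P) : forall sigma,
  tr K (esubst sigma t) = dsubst (fun n => tr K (sigma n)) (tr K t).
Proof.
  assert (up : forall t (sigma : nat -> eterm P),
             dsubst (fun n => tr K (eup sigma n)) t = dsubst (dup (fun n => tr K (sigma n))) t).
  { intros; apply dsubst_ext; intros [|n]; simpl; [reflexivity | apply tr_eren]. }
  induction t; intros sigma; simpl; unfold_cst; rewrite <- ?up; auto;
    repeat match goal with H : forall sigma, _ = _ |- _ => rewrite H; clear H end;
    reflexivity.
Qed.

Lemma tr_esubst1 (B N : eterm P) : tr K (esubst1 B N) = dsubst1 (tr K B) (tr K N).
Proof.
  unfold esubst1, dsubst1; rewrite tr_esubst; apply dsubst_ext; intros [|n]; reflexivity.
Qed.

Lemma tr_estep (M N : eterm P) : estep M N -> dconv T (tr K M) (tr K N).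
Proof.
  induction 1; simpl.
  1: { eapply rst_trans; [apply dconv_dapp_dabs|].
       rewrite tr_esubst1; apply rst_step, dstep_beta. }
  (* A step in [A] reappears in the domains of the translated abstractions, so several arguments are
     converted together. *)
  all: apply dconv_cst; repeat apply Vector.Forall2_cons; try apply Vector.Forall2_nil;
    try assumption; try apply rst_refl;
    (apply dconv_lam; [apply dconv_dEl|]; (assumption || apply rst_refl)).
Qed.

Lemma tr_econv (M N : eterm P) : econv M N -> dconv T (tr K M) (tr K N).
Proof.
  induction 1; [apply tr_estep; assumption | apply rst_refl | apply rst_sym; assumption
               | eapply rst_trans; eassumption].
Qed.

Lemma dty_conv_dU D t s s' :
  dty T D t (dU s) -> dty T D s' hatS -> dconv T s s' -> dty T D t (dU s').
Proof.
  intros Ht Hs' Hc; apply dty_conv with (dU s) DType;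
    [assumption | apply dty_dU; assumption | left; reflexivity | apply dconv_dU; assumption].
Qed.

Lemma dty_conv_dEl D t s A s' A' :
  dty T D t (dEl s A) -> dty T D s' hatS -> dty T D A' (dU s') ->
  dconv T s s' -> dconv T A A' -> dty T D t (dEl s' A').
Proof.
  intros Ht Hs' HA' Hs HA; apply dty_conv with (dEl s A) DType;
    [assumption | apply dty_dEl; assumption | left; reflexivity | apply dconv_dEl; assumption].
Qed.

Lemma dty_du_dot D s s' : dwf T D -> ax P s s' -> dty T D (du (dot K s)) (dU (dot K s')).
Proof.
  intros HD Hs; apply dty_conv_dU with (hatA (dot K s));
    auto using dot_dty, ax_dconv, dty_du.
Qed.

Lemma dty_dU_of_dEl D t s s' : dwf T D ->
  dty T D t (dEl s' (du (dot K s))) -> dty T D t (dU (dot K s)).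
Proof.
  intros HD Ht; eapply dty_conv;
    [eassumption | apply dty_dU, dot_dty, HD | left; reflexivity | apply dconv_dEl_du].
Qed.

(** The axiom makes the target type well formed: it places [du (dot K s)] in [dU (dot K s')]. *)
Lemma dty_dEl_of_dU D t s s' : dwf T D -> ax P s s' ->
  dty T D t (dU (dot K s)) -> dty T D t (dEl (dot K s') (du (dot K s))).
Proof.
  intros HD Hs Ht; eapply dty_conv; [eassumption | | left; reflexivity |].
  - apply dty_dEl; auto using dot_dty, dty_du_dot.
  - apply rst_sym, dconv_dEl_du.
Qed.

Lemma dty_app_dot D X B s N :
  dty T D B (DPi X (dU (dot K s))) -> dty T D N X -> dty T D (DApp B N) (dU (dot K s)).
Proof.
  intros HB HN; assert (H := dty_app _ _ _ _ _ _ HB HN).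
  unfold dsubst1, dU in H; simpl in H; rewrite dsubst_dot in H; exact H.
Qed.

Lemma dty_lam_dot D X B s : dty T D X DType -> dty T (X :: D) B (dU (dot K s)) ->
  dty T D (DLam X B) (DPi X (dU (dot K s))).
Proof.
  intros HX HB; eapply dty_abs; [assumption | | left; reflexivity | assumption].
  apply dty_dU, dot_dty, dwf_decl, HX.
Qed.

(** * Preservation of typing *)

Lemma ax_of_ety G s s' : ety G (ESort s) (ESort s') -> ax P s s'.
Proof.
  intros (s'' & Hax & <-%econv_sort_inj)%ety_generation; assumption.
Qed.

Lemma rl_of_ety G s1 s2 s3 A B : ety G (EProd s1 s2 A B) (ESort s3) -> rl P s1 s2 s3.
Proof.
  intros (s' & Hrl & <-%econv_sort_inj)%ety_generation; assumption.
Qed.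

Lemma tr_ctx_nth G D n A : tr_ctx K G D -> nth_error G n = Some A ->
  exists F G' s, G = F ++ G' /\ length F = S n /\ ety G' A (ESort s) /\
    nth_error D n = Some (dEl (dot K s) (tr K A)).
Proof.
  intros HD; revert n; induction HD as [|G D B s HD IH HB]; intros [|n] Hn; try discriminate.
  - injection Hn as ->; exists (A :: nil), G, s; auto.
  - destruct (IH n Hn) as (F & G' & s' & -> & HF & HA & HDn).
    exists (B :: F), G', s'; simpl; auto.
Qed.

(** The induction invariant. It covers every sort of [A], so that its user may choose the
    derivation, and it includes well-formedness of [D], which rules without an [ewf] premise obtain
    from their subderivations. *)
Definition tr_typed (G : ectx P) (M A : eterm P) : Prop :=
  forall D, tr_ctx K G D -> dwf T D /\
    forall s, ety G A (ESort s) -> dty T D (tr K M) (dEl (dot K s) (tr K A)).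

(** Totality gives [s] a sort, at which the invariant yields a [dEl] type; the rule for [dEl] on
    [du] turns it into [dU]. *)
Lemma tr_typed_sort G D M s : ewf G -> tr_ctx K G D -> tr_typed G M (ESort s) ->
  dty T D (tr K M) (dU (dot K s)).
Proof.
  intros HG HD HM; destruct (HM D HD) as [HwD HM'].
  destruct (proj1 P_total s) as (s' & Hs).
  eapply dty_dU_of_dEl; [assumption | apply HM'; constructor; eassumption].
Qed.

(** The premises on [A] and [B] are shared by products, abstractions and applications. *)
Lemma tr_typed_dProd G D s1 s2 A B : tr_ctx K G D ->
  ety G A (ESort s1) -> ety (A :: G) B (ESort s2) ->
  tr_typed G A (ESort s1) -> tr_typed (A :: G) B (ESort s2) ->
  let X := dEl (dot K s1) (tr K A) in
  dwf T D /\ dty T D X DType /\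
  dty T D (tr K A) (dU (dot K s1)) /\
  dty T (X :: D) (tr K B) (dU (dot K s2)) /\
  dty T D (DLam X (tr K B)) (DPi X (dU (dot K s2))).
Proof.
  intros HD HA HB IHA IHB X.
  assert (HwD := proj1 (IHA D HD)).
  assert (HtA := tr_typed_sort G D A s1 (ety_ewf _ _ _ HA) HD IHA).
  assert (HtB := tr_typed_sort (A :: G) (X :: D) B s2 (ety_ewf _ _ _ HB)
                   (tr_ctx_decl K _ _ _ _ HD HA) IHB).
  assert (HX : dty T D X DType) by (apply dty_dEl; auto using dot_dty).
  repeat (split; [assumption|]); apply dty_lam_dot; assumption.
Qed.

Scheme ewf_mutual := Minimality for ewf Sort Prop
  with ety_mutual := Minimality for ety Sort Prop.
Combined Scheme ewf_ety_mutual from ewf_mutual, ety_mutual.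

Lemma tr_preserves :
  (forall G : ectx P, ewf G -> forall D, tr_ctx K G D -> dwf T D) /\
  (forall (G : ectx P) M A, ety G M A -> tr_typed G M A).
Proof.
  apply ewf_ety_mutual.
  - intros D HD; inversion HD; constructor.
  - intros G A s HA IH D HD; inversion HD as [|G' D' A' s' HD' HA']; subst.
    (* The sort chosen in [D] might differ from the one in the derivation; uniqueness identifies
       them. *)
    rewrite (ety_unique_sort P_functional _ _ _ _ HA' HA).
    apply dwf_decl, dty_dEl; [apply dot_dty, (IH D' HD') |].
    exact (tr_typed_sort _ _ _ _ (ety_ewf _ _ _ HA) HD' IH).
  - intros G n A HG IH Hn D HD; split; [auto|]; intros s Hs.
    destruct (tr_ctx_nth _ _ _ _ HD Hn) as (F & G' & s' & -> & HF & HA & HDn).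
    (* The context records the sort of the declared type before weakening, the goal its sort
       after. *)
    assert (Hs' : s' = s).
    { rewrite <- HF in Hs; apply (ety_unique_sort P_functional _ _ _ _
        (ety_weaken F G' A (ESort s') HG HA) Hs). }
    subst s'; rewrite tr_eren, <- (dren_dot (fun m => S n + m) s).
    exact (dty_var T D n _ (IH D HD) HDn).
  - intros G s1 s2 HG IH Hax D HD; split; [auto|]; intros s Hs.
    apply ax_of_ety in Hs; apply dty_dEl_of_dU; auto.
    apply dty_du_dot; auto.
  - intros G s1 s2 s3 A B HA IHA HB IHB Hrl D HD; split; [apply (IHA D HD)|]; intros s Hs.
    destruct (tr_typed_dProd G D s1 s2 A B HD HA HB IHA IHB) as (HwD & HX & HtA & HtB & Hlam).
    apply ax_of_ety in Hs; apply dty_dEl_of_dU; auto.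
    apply dty_conv_dU with (hatR (dot K s1) (dot K s2)); auto using dot_dty, rl_dconv.
    apply dty_dProd; rewrite ?dren_dot; auto using dot_dty.
  - intros G s1 s2 A B M HA IHA HB IHB HM IHM D HD; split; [apply (IHA D HD)|]; intros s Hs.
    destruct (tr_typed_dProd G D s1 s2 A B HD HA HB IHA IHB) as (HwD & HX & HtA & HtB & Hlam).
    set (X := dEl (dot K s1) (tr K A)) in *.
    assert (HtM := proj2 (IHM (X :: D) (tr_ctx_decl K _ _ _ _ HD HA)) s2 HB).
    (* The declaration of [dabs] expects the body in the family applied to the bound variable; this
       redex contracts to [tr K B], the type the body has. *)
    assert (Happ : dty T (X :: D) (DApp (dren S (DLam X (tr K B))) (DVar 0)) (dU (dot K s2))).
    { apply dty_app_dot with (dren S X).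
      - assert (H := dty_weaken _ _ _ _ _ HX Hlam).
        unfold dU in H |- *; cbn [dren Vector.map] in H.
        rewrite dren_dot in H; exact H.
      - exact (dty_var T (X :: D) 0 X (dwf_decl _ _ _ HX) eq_refl). }
    apply rl_of_ety in Hs.
    assert (HProd : dty T D (tr K (EProd s1 s2 A B)) (dU (hatR (dot K s1) (dot K s2)))).
    { apply dty_dProd; rewrite ?dren_dot; auto using dot_dty. }
    simpl; apply dty_conv_dEl with (hatR (dot K s1) (dot K s2)) (tr K (EProd s1 s2 A B));
      [| apply dot_dty, HwD | eapply dty_conv_dU; eauto using dot_dty, rl_dconv
       | apply rl_dconv, Hs | apply rst_refl].
    apply dty_dabs; rewrite ?dren_dot; auto using dot_dty.
    eapply dty_abs; [exact HX | | left; reflexivity |].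
    + apply dty_dEl; [apply dot_dty, dwf_decl, HX | exact Happ].
    + apply dty_conv_dEl with (dot K s2) (tr K B);
        [exact HtM | apply dot_dty, dwf_decl, HX | exact Happ | apply rst_refl |].
      rewrite <- (dsubst1_dren_up (tr K B)) at 1.
      apply rst_sym, rst_step, dstep_beta.
  - intros G s1 s2 A B M N HA IHA HB IHB HN IHN HM IHM D HD;
      split; [apply (IHA D HD)|]; intros s Hs.
    destruct (tr_typed_dProd G D s1 s2 A B HD HA HB IHA IHB) as (HwD & HX & HtA & HtB & Hlam).
    set (X := dEl (dot K s1) (tr K A)) in *.
    assert (E : s = s2).
    { apply (ety_unique_sort P_functional _ _ _ _ Hs).
      exact (ety_esubst1 _ _ (ESort s2) _ _ _ HA HN HB). }
    subst s.
    assert (HtN := proj2 (IHN D HD) s1 HA).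
    (* [s3] is the sort of the product, the index at which the invariant types [M]. *)
    destruct (proj2 P_total s1 s2) as (s3 & Hrl).
    assert (HtM := proj2 (IHM D HD) s3 (ety_prod _ _ _ _ _ _ HA HB Hrl)).
    assert (HProd : dty T D (tr K (EProd s1 s2 A B)) (dU (hatR (dot K s1) (dot K s2)))).
    { apply dty_dProd; rewrite ?dren_dot; auto using dot_dty. }
    apply dty_conv_dEl with (dot K s2) (DApp (DLam X (tr K B)) (tr K N)).
    + apply dty_dapp; rewrite ?dren_dot; auto using dot_dty.
      apply dty_conv_dEl with (dot K s3) (tr K (EProd s1 s2 A B));
        [exact HtM | apply dty_hatR; auto using dot_dty | exact HProd
        | apply rst_sym, rl_dconv, Hrl | apply rst_refl].
    + apply dot_dty, HwD.
    (* The contractum of the family applied to [N] is typed by substituting [N] into [HtB]. *)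
    + rewrite tr_esubst1.
      assert (H := dty_dsubst1 _ _ _ _ _ _ HtN HtB).
      unfold dsubst1 at 2, dU in H; cbn [dsubst Vector.map] in H.
      rewrite dsubst_dot in H; exact H.
    + apply rst_refl.
    + rewrite tr_esubst1; apply rst_step, dstep_beta.
  - intros G M A B s HM IHM HB IHB Hconv D HD; split; [apply (IHM D HD)|]; intros s' Hs'.
    rewrite (ety_unique_sort P_functional _ _ _ _ Hs' HB); clear s' Hs'.
    (* [A] has some sort, and by conversion it is that of [B], so only the second argument of [dEl]
       is converted. *)
    destruct (ety_type_correct P_total _ _ _ HM) as (sA & HA).
    assert (E := econv_unique_sort P_functional P_total _ _ _ _ _ Hconv HA HB); subst sA.
    assert (HwD := proj1 (IHM D HD)).
    apply dty_conv_dEl with (dot K s) (tr K A);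
      [apply (proj2 (IHM D HD)), HA | apply dot_dty, HwD
      | exact (tr_typed_sort _ _ _ _ (ety_ewf _ _ _ HB) HD IHB)
      | apply rst_refl | apply tr_econv, Hconv].
Qed.

Lemma tr_ctx_unique (G : ectx P) : ewf G -> exists D, unique (tr_ctx K G) D.
Proof.
  induction G as [|A G IH]; intros HG.
  - exists nil; split; [constructor | intros D HD; inversion HD; reflexivity].
  - inversion HG as [|G' A' s HA]; subst.
    destruct (IH (ety_ewf _ _ _ HA)) as (D & HD & HDu).
    exists (dEl (dot K s) (tr K A) :: D); split; [constructor; assumption|].
    intros D' HD'; inversion HD' as [|G' D'' A' s' HD'' HA']; subst.
    rewrite (ety_unique_sort P_functional _ _ _ _ HA HA'), (HDu D''); auto.
Qed.

End Encoding.

Theorem mainTheorem19 (P : pts_spec)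
    (P_functional : pts_functional P) (P_total : pts_total P)
    (K : completion P) (K_sorts : represents_sorts K)
    (G : ectx P) (M A : eterm P) :
  (ewf G ->
   exists D, unique (tr_ctx K G) D /\ dwf (stheory K) D) /\
  (ety G M A ->
   exists D, unique (tr_ctx K G) D /\
   (forall s, A = ESort s -> top_sort P s ->
      dty (stheory K) D (tr K M) (dU (dot K s))) /\
   ((~ exists s, A = ESort s /\ top_sort P s) ->
      exists sA, unique (fun s => ety G A (ESort s)) sA /\
      dty (stheory K) D (tr K M) (dEl (dot K sA) (tr K A)))).
Proof.
  destruct (tr_preserves K P_functional P_total K_sorts) as [pres_wf pres_ty].
  split.
  - intros HG; destruct (tr_ctx_unique K P_functional G HG) as (D & HD).
    exists D; split; [exact HD | exact (pres_wf G HG D (proj1 HD))].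
  - intros HM.
    destruct (tr_ctx_unique K P_functional G (ety_ewf _ _ _ HM)) as (D & HD).
    exists D; split; [exact HD | split].
    (* Totality of [ax] leaves no top-sort, so this clause is vacuous. *)
    + intros s _ Htop; destruct (Htop (proj1 P_total s)).
    + intros _; destruct (ety_type_correct P_total _ _ _ HM) as (sA & HA).
      exists sA; split.
      * split; [exact HA | intros s Hs; exact (ety_unique_sort P_functional _ _ _ _ HA Hs)].
      * exact (proj2 (pres_ty G M A HM D (proj1 HD)) sA HA).
Qed.
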